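(* Let $\mathcal{H}$ be a real Hilbert space, $f:\mathcal{H}\to\mathbb{R}$ a convex function with $\operatorname{argmin} f\neq\emptyset$, $\tilde f:\mathcal{H}\times[0,\infty)\to\mathbb{R}$ a smoothing function of $f$ (in the sense of the context), $\alpha>3$, $t_0>0$, and let $\mu:[0,\infty)\to[0,\infty)$ be continuously differentiable and strictly decreasing with $\lim_{t\to\infty}\mu(t)=0$ and $\int_{t_0}^\infty t\mu(t)\,dt<\infty$. Let $g:[t_0,\infty)\to\mathcal{H}$ be (strongly) measurable with $\int_{t_0}^\infty t\|g(t)\|\,dt<\infty$, and let $x:[t_0,\infty)\to\mathcal{H}$ be a trajectory of $$\ddot x(t)+\frac{\alpha}{t}\dot x(t)+\nabla_x\tilde f(x(t),\mu(t))=g(t).$$ Then $x(t)$ converges weakly in $\mathcal{H}$, as $t\to\infty$, to an element of $\operatorname{argmin} f$.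
   Context: A function $\tilde f:\mathcal{H}\times[0,\infty)\to\mathbb{R}$ is called a smoothing function of the convex function $f:\mathcal{H}\to\mathbb{R}$ if: (i) for each fixed $\mu>0$, $\tilde f(\cdot,\mu)$ is continuously differentiable on $\mathcal{H}$, and for each fixed $x\in\mathcal{H}$, $\tilde f(x,\cdot)$ is continuously differentiable on $(0,\infty)$; (ii) $\lim_{z\to x,\ \mu\downarrow 0}\tilde f(z,\mu)=f(x)$ for all $x\in\mathcal{H}$; (iii) $\tilde f(\cdot,\mu)$ is convex on $\mathcal{H}$ for each fixed $\mu>0$; (iv) there is a constant $\kappa>0$ with $|\nabla_\mu\tilde f(x,\mu)|\le\kappa$ for all $\mu\in(0,\infty)$, $x\in\mathcal{H}$; (v) there is a constant $L>0$ such that for every $\mu\in(0,\infty)$, $\nabla_x\tilde f(\cdot,\mu)$ is Lipschitz continuous on $\mathcal{H}$ with constant $L\mu^{-1}$; (vi) for each fixed $z\in\mathcal{H}$, $\mu\mapsto\nabla_z\tilde f(z,\mu)$ is continuous on $(0,\infty)$. Here $\nabla_x\tilde f$ and $\nabla_\mu\tilde f$ denote the gradient in the first variable and the derivative in the second variable. A trajectory is a continuously differentiable function $x:[t_0,\infty)\to\mathcal{H}$ whose derivative $\dot x$ is locally absolutely continuous and which satisfies the differential equation for almost every $t\ge t_0$. Since $\mu$ is strictly decreasing with limit $0$, one has $\mu(t)>0$ for all $t\geq 0$. *)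

(* Defs.v *)
From HB Require Import structures.
From mathcomp Require Import all_boot all_order all_algebra.
From mathcomp Require Import all_classical all_reals all_analysis.

Set Implicit Arguments.
Unset Strict Implicit.
Unset Printing Implicit Defensive.

Import Order.TTheory GRing.Theory Num.Theory.
Import numFieldNormedType.Exports.

Local Open Scope ring_scope.
Local Open Scope classical_set_scope.

(* A real Hilbert space is a complete normed module [H] over [R : realType]
   together with a positive definite symmetric form [dot : {dot H for idfun}]
   such that [`|u| ^+ 2 = dot u u]; a map with domain [a, +oo[ is a total map
   on [R] whose values outside [a, +oo[ play no role. *)

Section Hilbert.
Context {R : realType} {H : completeNormedModType R}.
Variable dot : {dot H for idfun}.

(* The Riesz representative of the Frechet differential; the default value 0
   is only returned when no vector represents ['d f x]. *)
Definition grad (f : H -> R) (x : H) : H :=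
  xget 0 [set v | forall h, 'd f x h = dot v h].

Definition argmin (f : H -> R) : set H := [set x | forall y, f x <= f y].

Definition weakly_converges (x : R -> H) (l : H) : Prop :=
  forall y, dot (x t) y @[t --> +oo] --> dot l y.

(* No condition involves [ft x mu] for [mu <= 0]. *)
Record smoothing_function (f : H -> R) (ft : H -> R -> R) : Prop := {
  smoothing_C1_space : forall mu : R, 0 < mu ->
    (forall x, differentiable (ft^~ mu) x) /\ continuous (grad (ft^~ mu));
  smoothing_C1_param : forall (x : H) (mu : R), 0 < mu ->
    derivable (ft x) mu 1 /\ {for mu, continuous (ft x)^`()%classic};
  smoothing_limit : forall x,
    ft p.1 p.2 @[p --> filter_prod (nbhs x) (0 : R)^'+] --> f x;
  smoothing_convex : forall mu : R, 0 < mu -> convex_function setT (ft^~ mu);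
  smoothing_param_bound : exists2 kappa : R, 0 < kappa &
    forall (x : H) (mu : R), 0 < mu -> `|(ft x)^`()%classic mu| <= kappa;
  smoothing_lipschitz : exists2 L : R, 0 < L &
    forall mu : R, 0 < mu -> (L * mu^-1).-lipschitz (grad (ft^~ mu));
  smoothing_grad_continuous : forall (z : H) (mu : R), 0 < mu ->
    {for mu, continuous (fun m => grad (ft^~ m) z)} }.

End Hilbert.

Section Curves.
Context {R : realType} {V : normedModType R}.

(* [x] is continuously differentiable on [a, +oo[ with derivative [v], the
   derivative at the endpoint being one-sided. *)
Record C1_from (a : R) (x v : R -> V) : Prop := {
  C1_from_derive : forall t, a < t -> is_derive t (1 : R) x (v t);
  C1_from_right_derive : h^-1 *: (x (a + h) - x a) @[h --> (0 : R)^'+] --> v a;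
  C1_from_continuous : {within `[a, +oo[, continuous v} }.

Definition absolutely_continuous (a b : R) (v : R -> V) : Prop :=
  forall eps : R, 0 < eps -> exists2 delta : R, 0 < delta &
    forall (n : nat) (l r : 'I_n -> R),
      (forall i, a <= l i /\ l i <= r i /\ r i <= b) ->
      (forall i j, i != j -> r i <= l j \/ r j <= l i) ->
      \sum_(i < n) (r i - l i) < delta ->
      \sum_(i < n) `|v (r i) - v (l i)| < eps.

Definition locally_absolutely_continuous_from (a : R) (v : R -> V) : Prop :=
  forall b, a <= b -> absolutely_continuous a b v.

Definition vector_simple (s : R -> V) : Prop :=
  finite_set (range s) /\
  forall y, measurable (s @^-1` [set y] : set (measurableTypeR R)).

(* Almost-everywhere limit of simple functions. The sets [measurable] refers to
   are the Borel sets; allowing Lebesgue measurable sets in [vector_simple]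
   defines the same functions [g]. *)
Definition strongly_measurable_from (a : R) (g : R -> V) : Prop :=
  exists2 s : nat -> R -> V, (forall n, vector_simple (s n)) &
    {ae (@lebesgue_measure R), forall t, a <= t -> s n t @[n --> \oo] --> g t}.

End Curves.

Definition trajectory {R : realType} {H : completeNormedModType R}
    (dot : {dot H for idfun}) (ft : H -> R -> R) (alpha t0 : R) (mu : R -> R)
    (g x : R -> H) : Prop :=
  exists v : R -> H,
    [/\ C1_from t0 x v,
        locally_absolutely_continuous_from t0 v &
        {ae (@lebesgue_measure R), forall t, t0 <= t ->
          derivable v t 1 /\
          v^`()%classic t + (alpha / t) *: v t + grad dot (ft^~ (mu t)) (x t) = g t}].

(* Main.v *)
(* For a minimiser z, put gap(t) = ft(x(t), mu(t)) + kappa mu(t) - f(z) >= 0 and,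
   for 2 <= l <= alpha - 1,
     E_l = t^2 gap + |l (x - z) + t x'|^2 / 2 + l (alpha - 1 - l) |x - z|^2 / 2.
   Convexity and the equation give E_l' <= k (1 + E_l) almost everywhere with
   k = t |g| + 2 l kappa t mu integrable, so (1 + E_l) exp(- int k) is nonincreasing
   and E_l converges. Comparing l = 2 with l = alpha - 1 shows that
   t <x - z, x'> + (alpha - 1) |x - z|^2 / 2 converges, hence so does |x - z|; and
   gap <= E_l / t^2 gives f(x(t)) -> min f. Since each ft(., m) lies above its
   tangents, weak limit points of x(t) minimise f, and Opial's argument (with
   ultrafilters and the Riesz representation theorem in place of weak
   compactness) concludes. *)

Require Import Defs.
From HB Require Import structures.
From mathcomp Require Import all_boot all_order all_algebra.
From mathcomp Require Import all_classical all_reals all_analysis.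
From mathcomp Require Import measurable_realfun ring lra.

Set Implicit Arguments.
Unset Strict Implicit.
Unset Printing Implicit Defensive.

Import Order.TTheory GRing.Theory Num.Theory.
Import numFieldNormedType.Exports.

Local Open Scope ring_scope.
Local Open Scope classical_set_scope.

(** * Monotonicity from almost everywhere slopes *)

(** The obstacle is regularity. [ft] is assumed differentiable in each variable separately, so no
    chain rule is at hand for [ft (x t) (mu t)], and [v] is differentiable only almost everywhere.
    The energy is therefore handled through upper bounds alone: its upper Dini derivatives at almost
    every time, and a bound of its increments by a multiple of [t - s + |v t - v s|], which lets the
    absolute continuity of [v] absorb the exceptional null set. The energy is affine in l: expanding
    the square gives E_l = t^2 gap + t^2 |x'|^2 / 2 + l (t <x - z, x'> + (alpha - 1) |x - z|^2 / 2).
    Two values of l thus isolate the bracket, and alpha > 3 is what keeps the end points 2 and alpha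
    - 1 apart. At these end points one of the dissipation terms (l - 2) t gap and (alpha - 1 - l) t
    |x'|^2 vanishes; between them both are nonnegative. The 1 in 1 + E_l absorbs the term t <g, w>,
    w = l (x - z) + t x', through |w| <= 1 + |w|^2 / 2. *)

Lemma real_induction (R : realType) (a b : R) (P : R -> Prop) :
  a <= b -> P a ->
  (forall c, a <= c -> c <= b -> exists2 e, 0 < e &
    forall s t, a <= s -> c - e < s -> s <= c -> c <= t -> t < c + e ->
      t <= b -> P s -> P t) ->
  P b.
Proof.
(* The supremum of [S] cannot lie below [b]: [step] carries [P] from a point just left of the
   supremum across it, so one hypothesis plays both the closed and the open part of a connectedness
   argument. *)
move=> ab Pa step; pose S := [set t | a <= t <= b /\ P t].
have aS : S a by rewrite /S/= lexx ab.
have supS : has_sup S by split; [exists a | exists b => t [/andP[]]].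
have ubS t : S t -> t <= sup S by move=> St; apply: sup_upper_bound.
have ac := ubS _ aS.
have cb : sup S <= b by apply: ge_sup; [exists a | move=> t [/andP[]]].
have [e e0 He] := step _ ac cb.
have [s Ss hs] := sup_adherent e0 supS.
have sc := ubS _ Ss; case: Ss => /andP[as_ sb] Ps.
have [E|nE] := eqVneq (sup S) b.
  by rewrite -E; apply: (He s) => //; lra.
have cb' : sup S < b by rewrite lt_neqAle nE.
pose t := Num.min b (sup S + e / 2).
have [ct te tb] : [/\ sup S < t, t < sup S + e & t <= b].
  by rewrite /t; case: (leP b) => ?; split; lra.
have : S t.
  by split; [apply/andP; split; lra | apply: (He s) => //; lra].
by move=> /ubS; lra.
Qed.

(** [M t] is the measure of the part of [U] to the left of [t]. It acts as a budget: successive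
    intervals picked inside [U] up to time [t] have total length at most [M t], hence less than
    [d]. *)
Lemma negligible_cover (R : realType) (N : set R) (d : R) : 0 < d ->
  (@lebesgue_measure R).-negligible N ->
  exists U (M : R -> R), [/\ open U, N `<=` U,
    {homo M : s t / s <= t},
    forall s t, s <= t -> `[s, t] `<=` U -> M s + (t - s) <= M t &
    forall t, 0 <= M t < d].
Proof.
move=> d0 [B [mB B0 NB]].
have Boo : (lebesgue_measure B < +oo)%E by rewrite B0 ltry.
have [U [oO BO muOB]] := lebesgue_regularity_outer mB Boo d0.
have mO : measurable U by exact: open_measurable.
have muO : (lebesgue_measure U < d%:E)%E.
  apply: le_lt_trans muOB.
  apply: (@le_trans _ _ (lebesgue_measure ((U `\` B) `|` B))).
    apply: le_measure; rewrite ?inE//; first by apply: measurableU => //; exact: measurableD.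
    by move=> t Ot; have [?|?] := pselect (B t); [right|left].
  rewrite -[leRHS]adde0 -B0.
  exact: (measureU2 (@lebesgue_measure R) (measurableD _ _)).
pose I t : set R := U `&` `]-oo, t].
have mI t : measurable (I t) by exact: measurableI.
have Id t : (lebesgue_measure (I t) < d%:E)%E.
  by apply: le_lt_trans muO; apply: le_measure; rewrite ?inE; [exact: mI|exact: mO|move=> ? []].
have Ifin t : lebesgue_measure (I t) \is a fin_num.
  by rewrite ge0_fin_numE//; apply: lt_trans (Id t) (ltry _).
exists U, (fun t => fine (lebesgue_measure (I t))); split => //.
- by apply: subset_trans NB _.
- move=> s t st; apply: fine_le => //; apply: le_measure; rewrite ?inE; [exact: mI|exact: mI|].
  by move=> u [Ou]; rewrite /= !in_itv/= => us; split => //=; rewrite in_itv/= (le_trans us).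
- move=> s t st stO.
  have mst : lebesgue_measure (`]s, t]%classic : set R) = (t - s)%:E.
    rewrite lebesgue_measure_itv/= lte_fin; case: ltP => // ts.
    by rewrite (_ : t = s) ?subrr//; apply/eqP; rewrite eq_le st ts.
  rewrite -lee_fin EFinD !fineK// -mst -measureU; [|exact: mI|exact: measurable_itv|].
  + apply: le_measure; rewrite ?inE; [apply: measurableU => //; exact: mI|exact: mI|].
    move=> u [[Ou]|]; rewrite /= !in_itv/=.
      by move=> us; split => //=; rewrite in_itv/= (le_trans us).
    move=> /andP[su ut]; split; last by rewrite /= in_itv.
    by apply: stO; rewrite /= in_itv/= ut ltW.
  + apply/seteqP; split => // u [[_]]; rewrite /= !in_itv/= => us /andP[su].
    by have := le_lt_trans us su; rewrite ltxx.
- move=> t; apply/andP; split; first exact: fine_ge0.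
  by rewrite -lte_fin fineK.
Qed.

Lemma is_derive1_slope (R : realType) (V : normedModType R) (f : R -> V) (t : R) (d : V) :
  is_derive t 1 f d <-> h^-1 *: (f (t + h) - f t) @[h --> (0 : R)^'] --> d.
Proof.
have E : (fun h : R => h^-1 *: ((f \o shift t) (h *: 1) - f t)) =
    (fun h => h^-1 *: (f (t + h) - f t)).
  by apply/funext => h /=; rewrite (_ : h%:A = h) ?[t + h]addrC//; exact: mulr1.
split => [[+ <-]|cf]; first by rewrite /derivable /derive E.
have cg : h^-1 *: ((f \o shift t) (h *: 1) - f t) @[h --> (0 : R)^'] --> d by rewrite E.
by split; [exact: (cvgP d cg)|exact: (cvg_lim (@norm_hausdorff _ _) cg)].
Qed.

Lemma is_derive1_shift_cvg (R : realType) (V : normedModType R) (f : R -> V) (t : R) (d : V) :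
  is_derive t 1 f d -> f (t + h) @[h --> (0 : R)^'] --> f t.
Proof.
move=> /is_derive1_slope fd.
have h0 : h @[h --> (0 : R)^'] --> (0 : R) by exact: nbhs_dnbhs.
have cv : f t + h *: (h^-1 *: (f (t + h) - f t)) @[h --> (0 : R)^'] --> f t + 0 *: d.
  by apply: cvgD; [exact: cvg_cst|exact: cvgZ].
rewrite scale0r addr0 in cv; apply: cvg_trans cv; apply: near_eq_cvg.
near=> h; have h_neq0 : h != 0 by near: h; exact: nbhs_dnbhs_neq.
by rewrite /= scalerA divff// scale1r addrC subrK.
Unshelve. all: by end_near. Qed.

Section upper_slope.
Variable R : realType.
Implicit Types (psi : R -> R) (c d : R).

(* Both upper Dini derivatives of [psi] at [c] are at most [d]. *)
Definition upper_slope psi c d := forall e, 0 < e ->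
  \forall s \near c, (psi s - psi c) * (s - c) <= (d + e) * (s - c) ^+ 2.

(* Outside an open cover [U] of the exceptional null set, the slope condition
   bounds the increments of [psi]; inside [U], absolute continuity of [v] does. *)
Lemma ac_nonincreasing (V : normedModType R) (v : R -> V) psi (a b C : R) :
  a <= b -> absolutely_continuous a b v ->
  (forall s t, a <= s -> s <= t -> t <= b ->
    psi t - psi s <= C * (t - s + `|v t - v s|)) ->
  {ae (@lebesgue_measure R), forall t, a <= t -> t <= b -> upper_slope psi t 0} ->
  psi b <= psi a.
Proof.
move=> ab acv psiv psi0.
have N0 : (@lebesgue_measure R).-negligible
  (~` [set t | a <= t -> t <= b -> upper_slope psi t 0]) by exact: psi0.
wlog C0 : C psiv / 0 <= C.
  move=> h; apply: (h (Num.max 0 C)); last by rewrite le_max lexx.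
  move=> s t as_ st tb; apply: le_trans (psiv _ _ as_ st tb) _.
  by apply: ler_wpM2r; rewrite ?le_max ?lexx ?orbT// addr_ge0// subr_ge0.
apply/ler_addgt0Pr => e0 e00.
(* The final bound is [e * (b - a) + C * (e + e)], the first term coming from the slopes and the
   second from the intervals in [U]. The summand 1 keeps the denominator positive. *)
pose e := e0 / (b - a + 2 * C + 1).
have e_gt0 : 0 < e by apply: divr_gt0 => //; nra.
have [d1 d10 acd] := acv _ e_gt0.
pose d := Num.min d1 e.
have d_gt0 : 0 < d by rewrite lt_min d10.
have [U [M [oO NO Mmono Mstep Md]]] := negligible_cover d_gt0 N0.
(* The invariant keeps a finite list of intervals, each added while crossing [U], within the budget
   [M t]; apart from them [psi] grows at rate at most [e]. *)
pose P (t : R) := exists n (l r : nat -> R),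
  [/\ forall i, (i < n)%N -> [/\ a <= l i, l i <= r i & r i <= t],
      forall i j, (i < n)%N -> (j < n)%N -> i != j -> r i <= l j \/ r j <= l i,
      \sum_(i < n) (r i - l i) <= M t &
      psi t - psi a <= e * (t - a) +
        \sum_(i < n) C * (r i - l i + `|v (r i) - v (l i)|)].
suff : P b.
  move=> [n [l [r [lr disj len]]]].
  have lend : \sum_(i < n) (r i - l i) < d by apply: le_lt_trans len _; have /andP[] := Md b.
  have {}acd : \sum_(i < n) `|v (r i) - v (l i)| < e.
    apply: (acd n (fun i => l i) (fun i => r i)).
    - by move=> i; have [? ? ?] := lr i (ltn_ord i).
    - by move=> i j ij; apply: disj.
    - by apply: lt_le_trans lend _; rewrite ge_min lexx.
  have lene : \sum_(i < n) (r i - l i) < e.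
    by apply: lt_le_trans lend _; rewrite ge_min lexx orbT.
  rewrite -mulr_sumr big_split/= => psib.
  have : C * (\sum_(i < n) (r i - l i) + \sum_(i < n) `|v (r i) - v (l i)|) <= C * (e + e).
    by apply: ler_wpM2l => //; apply: lerD; exact: ltW.
  have : e * (b - a + 2 * C + 1) = e0 by rewrite /e divfK// gt_eqF//; lra.
  by lra.
apply: (real_induction ab).
- exists 0%N, (fun=> 0), (fun=> 0); split => //.
    by rewrite big_ord0; have /andP[] := Md a.
  by rewrite big_ord0 !subrr mulr0 addr0.
- move=> c ac cb; have [Oc|NOc] := pselect (U c).
  + have /nbhs_ballP[eta /= eta0 ballO] : nbhs c U by exact: open_nbhs_nbhs.
    exists eta => // s t as_ cs sc ct tc tb [n [l [r [lr disj len psis]]]].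
    have st := le_trans sc ct.
    have stO : `[s, t] `<=` U.
      move=> u; rewrite /= in_itv/= => /andP[su ut]; apply: ballO.
      by rewrite /ball/= ltr_norml; apply/andP; split; lra.
    exists n.+1, (fun i => if (i == n)%N then s else l i),
      (fun i => if (i == n)%N then t else r i); split.
    * move=> i; rewrite ltnS leq_eqVlt; case: eqP => [_ _|_ /= /lr[? ? ?]]; first by split.
      by split => //; lra.
    * move=> i j; rewrite !ltnS (leq_eqVlt i) (leq_eqVlt j); case: eqP => [->|_]; case: eqP => [->|_] //=.
      - by rewrite eqxx.
      - by move=> _ /lr[_ _ ?] _; right.
      - by move=> /lr[_ _ ?] _ _; left.
      - exact: disj.
    * rewrite big_ord_recr/= eqxx.
      under eq_bigr => i _ do rewrite (ltn_eqF (ltn_ord i)).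
      by apply: le_trans (Mstep _ _ st stO); rewrite lerD2r.
    * rewrite big_ord_recr/= eqxx.
      under eq_bigr => i _ do rewrite (ltn_eqF (ltn_ord i)).
      have := psiv _ _ as_ st tb; have : 0 <= e * (t - s) by apply: mulr_ge0; lra.
      by lra.
  (* No interval is added here: the slope at [c] bounds the increment on both sides, from [s] to [c]
     and from [c] to [t]. *)
  + have slope : upper_slope psi c 0.
      by apply: contrapT => h; apply: NOc; apply: NO => /= /(_ ac cb).
    have /nbhs_ballP[eta /= eta0 balls] := slope _ e_gt0.
    exists eta => // s t as_ cs sc ct tc tb [n [l [r [lr disj len psis]]]].
    exists n, l, r; split => //.
    * by move=> i /lr[? ? ?]; split => //; lra.
    * by apply: le_trans len (Mmono _ _ _); lra.
    * have h1 : psi t - psi c <= e * (t - c).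
        have [->|tc'] := eqVneq t c; first by rewrite !subrr mulr0.
        have /balls : ball c eta t by rewrite /ball/= ltr_norml; apply/andP; split; lra.
        by rewrite add0r expr2 mulrA ler_pM2r// subr_gt0 lt_neqAle eq_sym tc'.
      have h2 : psi c - psi s <= e * (c - s).
        have [->|tc'] := eqVneq s c; first by rewrite !subrr mulr0.
        have /balls : ball c eta s by rewrite /ball/= ltr_norml; apply/andP; split; lra.
        have cs0 : 0 < c - s by rewrite subr_gt0 lt_neqAle tc'.
        by move=> h; rewrite -(ler_pM2r cs0); lra.
      by lra.
Qed.

End upper_slope.

(** * Hilbert spaces *)

Section hilbert.
Context {R : realType} {H : completeNormedModType R}.
Variable dot : {dot H for idfun}.
Hypothesis norm_dot : forall u : H, `|u| ^+ 2 = dot u u.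

Lemma dotC u v : dot u v = dot v u.
Proof. by rewrite hermC/= expr0 mul1r. Qed.

Lemma dotDl u v w : dot (u + v) w = dot u w + dot v w.
Proof. exact: linearDl. Qed.

Lemma dotZl a u w : dot (a *: u) w = a * dot u w.
Proof. exact: linearZl. Qed.

Lemma dotDr u v w : dot w (u + v) = dot w u + dot w v.
Proof. by rewrite dotC dotDl !(dotC w). Qed.

Lemma dotZr a u w : dot w (a *: u) = a * dot w u.
Proof. by rewrite dotC dotZl dotC. Qed.

Lemma dotNl u w : dot (- u) w = - dot u w.
Proof. by rewrite -scaleN1r dotZl mulN1r. Qed.

Lemma dotNr u w : dot w (- u) = - dot w u.
Proof. by rewrite dotC dotNl dotC. Qed.

Definition dotE := (dotDl, dotDr, dotNl, dotNr, dotZl, dotZr).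

Lemma cauchy_schwarz u v : `|dot u v| <= `|u| * `|v|.
Proof.
have [->|v0] := eqVneq v 0; first by rewrite -(scale0r v) dotZr mul0r normr0 mulr_ge0.
have {}v0 : 0 < `|v| by rewrite normr_gt0.
rewrite -(@ler_pXn2r _ 2) ?nnegrE ?mulr_ge0// exprMn real_normK ?num_real//.
have : 0 <= `| `|v| ^+ 2 *: u - dot u v *: v| ^+ 2 by exact: sqr_ge0.
rewrite norm_dot !dotE -!norm_dot (dotC v u).
set d := dot u v; set a := `|v| ^+ 2; set b := `|u| ^+ 2.
have a0 : 0 < a by rewrite exprn_gt0.
by move=> h; rewrite -(ler_pM2l a0); lra.
Qed.

Lemma dot_cvg T (F : set_system T) (FF : Filter F) (u v : T -> H) (a b : H) :
  u @ F --> a -> v @ F --> b -> dot (u t) (v t) @[t --> F] --> dot a b.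
Proof.
move=> ua vb; pose h t : R := `|u t - a| * `|v t| + `|a| * `|v t - b|.
have norm0 (w : T -> H) c : w @ F --> c -> `|w t - c| @[t --> F] --> (0 : R).
  by move=> wc; apply/norm_cvg0P/subr_cvg0.
have h0 : h t @[t --> F] --> 0 * `|b| + `|a| * 0.
  by apply: cvgD; apply: cvgM; [exact: norm0|exact: cvg_norm|exact: cvg_cst|exact: norm0].
rewrite mul0r mulr0 addr0 in h0.
apply/subr_cvg0; apply: norm_cvg0.
apply: (squeeze_cvgr _ (cvg_cst (0 : R)) h0).
near=> t; rewrite normr_ge0/=.
have -> : dot (u t) (v t) - dot a b = dot (u t - a) (v t) + dot a (v t - b).
  by rewrite !dotE; lra.
by apply: le_trans (ler_normD _ _) _; apply: lerD; exact: cauchy_schwarz.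
Unshelve. all: by end_near. Qed.

Lemma dot_is_derive (u v : R -> H) (t : R) (du dv : H) :
  is_derive t 1 u du -> is_derive t 1 v dv ->
  is_derive t 1 (fun s => dot (u s) (v s)) (dot du (v t) + dot (u t) dv).
Proof.
move=> ud vd; apply/is_derive1_slope.
have /is_derive1_slope us := ud; have /is_derive1_slope vs := vd.
have vc := is_derive1_shift_cvg vd.
have cv : dot (h^-1 *: (u (t + h) - u t)) (v (t + h)) +
    dot (u t) (h^-1 *: (v (t + h) - v t)) @[h --> (0 : R)^'] -->
    dot du (v t) + dot (u t) dv.
  by apply: cvgD; apply: dot_cvg => //; exact: cvg_cst.
apply: cvg_trans cv; apply: near_eq_cvg; near=> h.
by rewrite /= !dotE /GRing.scale/=; lra.
Unshelve. all: by end_near. Qed.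

Lemma quadratic_ge0 (a b : R) : (forall s, 0 <= s * a + s ^+ 2 * b) -> a = 0.
Proof.
move=> h; have := h 1; have := h (-1).
have b0 : 0 <= b by have := h 1; have := h (-1); lra.
(* At [s = - c] with [c = a / (b + 1)] the expression equals [- c ^+ 2]; the shift [b + 1] avoids a
   separate case [b = 0]. *)
have := h (- (a / (b + 1))).
set c := a / (b + 1); have ac : a = c * (b + 1) by rewrite /c divfK// gt_eqF//; lra.
rewrite {1}ac => h1 _ _; suff : c = 0 by move=> c0; rewrite ac c0 mul0r.
have h2 : c ^+ 2 <= 0 by rewrite expr2; move: h1; rewrite expr2; nra.
by apply/eqP; rewrite -sqrf_eq0 eq_le h2 sqr_ge0.
Qed.

(* The representing vector minimises [J u = |u|^2 / 2 - phi u]; by the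
   parallelogram identity the sublevel sets of [J] form a Cauchy filter. *)
Lemma riesz_representation (phi : H -> R) (M : R) :
  (forall u v, phi (u + v) = phi u + phi v) ->
  (forall a u, phi (a *: u) = a * phi u) ->
  (forall u, `|phi u| <= M * `|u|) ->
  exists u, forall y, phi y = dot u y.
Proof.
move=> phiD phiZ phiM.
have phiN u : phi (- u) = - phi u by rewrite -scaleN1r phiZ mulN1r.
pose J u := `|u| ^+ 2 / 2 - phi u.
have infJ : has_inf (range J).
  split; first by exists (J 0), 0.
  exists (- (M ^+ 2 / 2)) => _ [u _ <-]; rewrite /J.
  have /ler_normlP[_ h] := phiM u.
  have := sqr_ge0 (`|u| - M); rewrite !expr2; lra.
have Jge u : inf (range J) <= J u by apply: ge_inf; [case: infJ|exists u].
set m := inf (range J) in Jge.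
pose B (e : R) := [set u | J u < m + e].
(* The infimum is compared with the value of [J] at the midpoint of [u] and [v]. *)
have par u v : `|u - v| ^+ 2 <= 4 * (J u + J v - 2 * m).
  have := Jge (2^-1 *: (u + v)); rewrite /J phiZ phiD !norm_dot !dotE (dotC v u).
  lra.
pose F := filter_from [set e : R | 0 < e] B.
have FF : ProperFilter F.
  apply: filter_from_proper.
    apply: filter_from_filter; first by exists 1 => /=.
    move=> e1 e2 /= e10 e20; exists (Num.min e1 e2); first by rewrite /= lt_min e10.
    by move=> u; rewrite /B/= => h; split; apply: lt_le_trans h _; rewrite lerD2l ge_min lexx ?orbT.
  move=> e /= e0; have [_ [u _ <-] hu] := inf_adherent e0 infJ.
  by exists u.
have cF : cauchy F.
  apply/cauchy_ballP => e e0.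
  (* The two excesses over [m] sum to less than [e ^+ 2 / 4], and [par] multiplies this by 4. *)
  exists (B (e ^+ 2 / 8), B (e ^+ 2 / 8)).
    by split; exists (e ^+ 2 / 8) => //=; rewrite divr_gt0 ?exprn_gt0.
  move=> [u v] [/= Bu Bv]; rewrite -ball_normE/=.
  rewrite -(@ltr_pXn2r _ 2) ?nnegrE// ?ltW//.
  by apply: le_lt_trans (par u v) _; move: Bu Bv; rewrite /B/=; lra.
have [u Fu] : exists u : H, F --> u by exists (lim F); exact: cauchy_cvg.
exists u.
have phic : phi v @[v --> F] --> phi u.
  apply/subr_cvg0; apply: norm_cvg0.
  have h0 : M * `|v - u| @[v --> F] --> M * 0.
    by apply: cvgM; [exact: cvg_cst|apply/norm_cvg0P/subr_cvg0].
  rewrite mulr0 in h0.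
  apply: (squeeze_cvgr _ (cvg_cst (0 : R)) h0).
  by near=> v; rewrite normr_ge0/= -phiN -phiD phiM.
have Jc : J v @[v --> F] --> J u.
  apply: cvgB => //; apply: cvgM; last exact: cvg_cst.
  rewrite norm_dot; under eq_fun do rewrite norm_dot.
  exact: dot_cvg.
have Ju : J u <= m.
  apply/ler_addgt0Pr => e e0.
  have e20 : 0 < e / 2 by rewrite divr_gt0.
  have h1 : \forall v \near F, J u - J v < e / 2.
    move/cvgrPdist_lt : Jc => /(_ _ e20); apply: filterS => v.
    by move=> /ltr_normlP[].
  have h2 : F (B (e / 2)) by exists (e / 2).
  have [v [/= v1 v2]] := filter_ex (filterI h1 h2).
  by move: v1 v2; rewrite /B/=; lra.
move=> y; apply/eqP; rewrite eq_sym -subr_eq0; apply/eqP.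
(* First variation at the minimiser: [J (u + s *: y) - J u] has linear coefficient [dot u y - phi y]
   in [s], which must vanish. *)
apply: (@quadratic_ge0 _ (`|y| ^+ 2 / 2)) => s.
have := le_trans Ju (Jge (u + s *: y)).
by rewrite /J phiD phiZ !norm_dot !dotE (dotC y u) !expr2; lra.
Unshelve. all: by end_near. Qed.

(** * Weak limits along ultrafilters and Opial's lemma *)

Lemma ultra_bounded_cvg T (U : set_system T) (f : T -> R) (M : R) :
  UltraFilter U -> (\forall t \near U, `|f t| <= M) ->
  exists l : R, f t @[t --> U] --> l.
Proof.
move=> UU fM.
have [|l [_ cl]] := @segment_compact R (- M) M (f @ U) _.
  by apply: filterS fM => t; rewrite /= in_itv/= ler_norml.
exists l => A Al; have [//|nA] := in_ultra_setVsetC (f @^-1` A) UU.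
by have [u [nAu Au]] := cl (~` A) _ nA Al.
Qed.

(** For each [y] the bounded numbers [dot (x t) y] converge along the ultrafilter. The limits form a
    linear functional of norm at most [M], and its Riesz vector is [p]. *)
Lemma weak_ultralimit T (U : set_system T) (x : T -> H) (M : R) :
  UltraFilter U -> (\forall t \near U, `|x t| <= M) ->
  exists p : H, forall y, dot (x t) y @[t --> U] --> dot p y.
Proof.
move=> UU xM.
have bnd y : \forall t \near U, `|dot (x t) y| <= M * `|y|.
  apply: filterS xM => t xt; apply: le_trans (cauchy_schwarz _ _) _.
  exact: ler_wpM2r.
have /choice[phi phiP] : forall y, exists l : R, dot (x t) y @[t --> U] --> l.
  by move=> y; exact: ultra_bounded_cvg (bnd y).
have uniq (f : T -> R) (a b : R) : f @ U --> a -> f @ U --> b -> a = b.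
  exact: (cvg_unique (@Rhausdorff R)).
have [p phip] : exists p, forall y, phi y = dot p y.
  apply: (@riesz_representation phi M).
  - move=> u v; apply: (uniq _ _ _ (phiP (u + v))).
    under eq_fun do rewrite dotDr.
    exact: cvgD.
  - move=> a u; apply: (uniq _ _ _ (phiP (a *: u))).
    under eq_fun do rewrite dotZr.
    by apply: cvgM => //; exact: cvg_cst.
  - move=> u; apply/ler_addgt0Pr => e e0.
    have /cvgrPdist_lt/(_ _ e0) h := phiP u.
    have [t [/= h1 h2]] := filter_ex (filterI h (bnd u)).
    rewrite -(subrK (dot (x t) u) (phi u)).
    by apply: le_trans (ler_normD _ _) _; lra.
by exists p => y; rewrite -phip.
Qed.

(** If [p] and [q] are two weak limits along ultrafilters, both in [S], then [dot (x t) (p - q)] is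
    up to constants half the difference of the squared distances to [q] and [p], so it converges at
    infinity. Its limits along the two ultrafilters, [dot p (p - q)] and [dot q (p - q)], therefore
    agree, and [p = q]. *)
Lemma opial (x : R -> H) (S : set H) : S !=set0 ->
  (forall z, S z -> exists l : R, `|x t - z| ^+ 2 @[t --> +oo] --> l) ->
  (forall (U : set_system R) p, UltraFilter U -> +oo `<=` U ->
    (forall y, dot (x t) y @[t --> U] --> dot p y) -> S p) ->
  exists2 p, S p & weakly_converges dot x p.
Proof.
move=> [z Sz] cvS clS.
have [M xM] : exists M, \forall t \near +oo, `|x t| <= M.
  have [l cl] := cvS _ Sz.
  exists (`|l| + 2 + `|z|).
  move/cvgrPdist_lt : cl => /(_ _ ltr01); apply: filterS => t xt.
  rewrite -{1}(subrK z (x t)); apply: le_trans (ler_normD _ _) _; rewrite lerD2r.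
  move: xt (ler_norm l) => /ltr_normlP[xt _].
  have := sqr_ge0 (`|x t - z| - 1); move: xt (normr_ge0 l); rewrite !expr2; lra.
have ul (U : set_system R) : UltraFilter U -> +oo `<=` U ->
    exists2 p, S p & forall y, dot (x t) y @[t --> U] --> dot p y.
  move=> UU oU; have [p xp] := weak_ultralimit UU (oU _ xM).
  by exists p => //; exact: (clS U).
have [U0 [UU0 oU0]] := @ultraFilterLemma _ (+oo : set_system R) _.
have [p Sp xp] := ul _ UU0 oU0.
exists p => // y A Ay; apply: contrapT => nA.
(* If weak convergence to [p] fails at [A], the bad times are frequent, and an ultrafilter
   containing them produces a second weak limit [q]. *)
pose G := within (~` [set t | A (dot (x t) y)]) (+oo : set_system R).
have GG : ProperFilter G.
  apply: Build_ProperFilter_ex => B.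
  rewrite /G/within/= => h; apply: contrapT => nB; apply: nA; apply: filterS h => t h.
  by apply: contrapT => /h Bt; apply: nB; exists t.
have [V [VV GV]] := ultraFilterLemma GG.
have oV : +oo `<=` V.
  by move=> B oB; apply: GV; apply: filterS oB.
have [q Sq xq] := ul _ VV oV.
have [lp clp] := cvS _ Sp; have [lq clq] := cvS _ Sq.
have pq : dot (x t) (p - q) @[t --> +oo] --> (lq - lp + `|p| ^+ 2 - `|q| ^+ 2) / 2.
  have E t : dot (x t) (p - q) = (`|x t - q| ^+ 2 - `|x t - p| ^+ 2 + `|p| ^+ 2 - `|q| ^+ 2) / 2.
    by rewrite !norm_dot !dotE (dotC p (x t)) (dotC q (x t)); lra.
  under eq_fun do rewrite E.
  apply: cvgM; last exact: cvg_cst.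
  by apply: cvgB; [apply: cvgD; [exact: cvgB|exact: cvg_cst]|exact: cvg_cst].
have lim_pq (W : set_system R) r : UltraFilter W -> +oo `<=` W ->
    (forall y, dot (x t) y @[t --> W] --> dot r y) ->
    dot r (p - q) = (lq - lp + `|p| ^+ 2 - `|q| ^+ 2) / 2.
  move=> WW oW xr.
  apply: (cvg_unique (@Rhausdorff R) (xr (p - q))).
  by move=> B /pq; exact: oW.
have : dot p (p - q) - dot q (p - q) = 0.
  by rewrite (lim_pq U0)// (lim_pq V)// subrr.
rewrite -dotNl -dotDl -norm_dot => /eqP; rewrite sqrf_eq0 normr_eq0 subr_eq0 => /eqP pqE.
have VA : V (~` [set t | A (dot (x t) y)]).
  by apply: GV; rewrite /G/within/=; apply: nearW.
have VA' : V [set t | A (dot (x t) y)] by apply: xq; rewrite -pqE.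
by have [t [/= ? ?]] := filter_ex (filterI VA VA').
Qed.

End hilbert.

(** * Smoothing functions *)

Lemma limr_le_near T (F : set_system T) (FF : ProperFilter F) (R : realType)
    (f : T -> R) (l c : R) :
  f t @[t --> F] --> l -> (\forall t \near F, f t <= c) -> l <= c.
Proof.
move=> fl fc; rewrite -(cvg_lim (@Rhausdorff R) fl).
by apply: limr_le => //; exact: (cvgP l fl).
Qed.

Section smoothing.
Context {R : realType} {H : completeNormedModType R}.
Variable dot : {dot H for idfun}.
Hypothesis norm_dot : forall u : H, `|u| ^+ 2 = dot u u.

(** The Frechet differential is a bounded linear form, so Riesz makes the set in the definition of
    [grad] nonempty and [xget] does not return its default value. *)
Lemma gradP (phi : H -> R) (x h : H) : differentiable phi x ->
  'd phi x h = dot (grad dot phi x) h.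
Proof.
move=> dphi; suff ex : exists v, forall h, 'd phi x h = dot v h.
  exact: (xgetPex 0 ex).
have cd : continuous 'd phi x by exact: diff_continuous.
have [M phiM] : exists M, forall u, `|'d phi x u| <= M * `|u|.
  have /linear_boundedP bd : bounded_near ('d phi x) (nbhs (0 : H)).
    exact/linear_bounded_continuous.
  by have [M hM] := filter_ex bd; exists M.
apply: (riesz_representation norm_dot _ _ phiM).
- by move=> u v; rewrite linearD.
- by move=> a u; rewrite linearZ.
Qed.

Lemma convex_gradient_le (phi : H -> R) (x y : H) :
  convex_function setT phi -> differentiable phi x ->
  phi x + dot (grad dot phi x) (y - x) <= phi y.
Proof.
move=> cphi dphi; rewrite -gradP// -lerBrDl -deriveE//.
have dx : derivable phi x (y - x) by exact: diff_derivable.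
have := dx; rewrite /derivable => cx.
have cx' : h^-1 *: ((phi \o shift x) (h *: (y - x)) - phi x) @[h --> (0 : R)^'+] -->
    'D_(y - x) phi x.
  exact: cvg_dnbhs_at_right cx.
apply: limr_le_near cx' _.
near=> h.
have h0 : 0 < h by near: h; exact: nbhs_right_gt.
have h1 : h <= 1 by near: h; exact: nbhs_right_le.
rewrite [leLHS](_ : _ = (phi (h *: (y - x) + x) - phi x) / h); last by rewrite mulrC.
rewrite ler_pdivrMr//; pose t : {i01 R} := Itv01 (ltW h0) h1.
have := cphi t y x; rewrite !inE => /(_ I I).
have -> : conv t (y : convex_lmodType H) x = h *: y + (1 - h) *: x by [].
rewrite convRE/= -[unstable.onem h]/(1 - h).
rewrite scalerBl scale1r scalerBr -[_ - _ + x]addrA [- _ + x]addrC; lra.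
Unshelve. all: by end_near. Qed.

Variables (f : H -> R) (ft : H -> R -> R).
Hypothesis fts : smoothing_function dot f ft.

Lemma smoothing_differentiable mu x : 0 < mu -> differentiable (ft^~ mu) x.
Proof. by move=> /(smoothing_C1_space fts)[]. Qed.

Lemma smoothing_gradient_le mu x y : 0 < mu ->
  ft x mu + dot (grad dot (ft^~ mu) x) (y - x) <= ft y mu.
Proof.
move=> mu0; apply: (@convex_gradient_le (ft^~ mu)); first exact: (smoothing_convex fts).
exact: smoothing_differentiable.
Qed.

Variable kappa : R.
Hypothesis kappaP : forall x mu, 0 < mu -> `|(ft x)^`()%classic mu| <= kappa.

Lemma smoothing_param_lipschitz x mu nu : 0 < nu -> nu <= mu ->
  `|ft x mu - ft x nu| <= kappa * (mu - nu).
Proof.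
move=> nu0 numu.
have der (m : R) : 0 < m -> is_derive m 1 (ft x) ((ft x)^`()%classic m).
  move=> m0; rewrite derive1E; apply/derivableP.
  exact: (smoothing_C1_param fts x m0).1.
have [m||c] := @MVT_segment _ (ft x) (ft x)^`()%classic nu mu numu.
- by rewrite in_itv/= => /andP[num _]; apply: der; exact: lt_trans num.
- apply: derivable_within_continuous => m; rewrite in_itv/= => /andP[num _].
  by have [] := der m (lt_le_trans nu0 num).
rewrite in_itv/= => /andP[nuc _] ->; rewrite normrM (ger0_norm (x := mu - nu)) ?subr_ge0//.
by apply: ler_wpM2r; rewrite ?subr_ge0// kappaP// (lt_le_trans nu0).
Qed.

Lemma smoothing_param_mono x mu nu : 0 < nu -> nu <= mu ->
  ft x nu + kappa * nu <= ft x mu + kappa * mu.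
Proof.
by move=> nu0 numu; have /ler_normlP[] := smoothing_param_lipschitz x nu0 numu; lra.
Qed.

Lemma smoothing_dist x mu : 0 < mu -> `|ft x mu - f x| <= kappa * mu.
Proof.
move=> mu0.
have fc : ft x nu @[nu --> (0 : R)^'+] --> f x.
  move=> A /(smoothing_limit fts)[[B C] [Bx C0] BC].
  by apply: filterS C0 => nu Cnu; apply: (BC (x, nu)); split => //; exact: nbhs_singleton.
have cv : `|ft x mu - ft x nu| @[nu --> (0 : R)^'+] --> `|ft x mu - f x|.
  by apply: cvg_norm; apply: cvgB => //; exact: cvg_cst.
apply: limr_le_near cv _; near=> nu.
have nu0 : 0 < nu by near: nu; exact: nbhs_right_gt.
have numu : nu <= mu by near: nu; exact: nbhs_right_le.
apply: le_trans (smoothing_param_lipschitz x nu0 numu) _.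
apply: ler_wpM2l; last by lra.
by apply: le_trans (kappaP x mu0).
Unshelve. all: by end_near. Qed.

Lemma smoothing_le x mu : 0 < mu -> f x <= ft x mu + kappa * mu.
Proof. by move=> /(smoothing_dist x)/ler_normlP[]; lra. Qed.

Lemma smoothing_ge x mu : 0 < mu -> ft x mu <= f x + kappa * mu.
Proof. by move=> /(smoothing_dist x)/ler_normlP[]; lra. Qed.

End smoothing.

(** * Calculus of slopes and increments *)

Section upper_slope_calculus.
Variable R : realType.
Implicit Types (A B psi : R -> R) (c d : R).

Lemma upper_slope_dnbhs psi c d :
  (forall e, 0 < e ->
    \forall h \near (0 : R)^', (psi (c + h) - psi c) * h <= (d + e) * h ^+ 2) ->
  upper_slope psi c d.
Proof.
move=> psid e /psid/nbhs_ballP[eta /= eta0 etah].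
apply/nbhs_ballP; exists eta => // s cs.
have [->|sc] := eqVneq s c; first by rewrite !subrr mulr0 expr0n/= mulr0.
have /etah : ball 0 eta (s - c).
  by move: cs; rewrite -!ball_normE/= sub0r normrN distrC.
by rewrite subr_eq0 (addrC c) subrK => /(_ sc).
Qed.

Lemma upper_slope_derive psi c d : is_derive c 1 psi d -> upper_slope psi c d.
Proof.
move=> /is_derive1_slope/cvgrPdist_lt psid; apply: upper_slope_dnbhs => e /psid.
apply: filter_app; near=> h => hd.
have h0 : h != 0 by near: h; exact: nbhs_dnbhs_neq.
have h2 : 0 < h ^+ 2 by rewrite exprn_even_gt0.
move: hd => /ltr_normlP[hd _].
rewrite -[leLHS](divfK (lt0r_neq0 h2)) ler_pM2r//.
rewrite [leLHS](_ : _ = h^-1 *: (psi (c + h) - psi c)); first lra.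
by rewrite expr2 [in RHS]/GRing.scale/=; field.
Unshelve. all: by end_near. Qed.

Lemma upper_slope_le psi c d d' : d <= d' -> upper_slope psi c d -> upper_slope psi c d'.
Proof.
move=> dd' psid e /psid; apply: filterS => s; move/le_trans; apply.
by apply: ler_wpM2r; rewrite ?sqr_ge0// lerD2r.
Qed.

Lemma upper_slopeD A B c d d' : upper_slope A c d -> upper_slope B c d' ->
  upper_slope (A \+ B) c (d + d').
Proof.
move=> Ad Bd' e e0; have e20 : 0 < e / 2 by rewrite divr_gt0.
apply: filterS2 (Ad _ e20) (Bd' _ e20) => s /=; lra.
Qed.

(** The increment splits as [(A s - A c) * B s + A c * (B s - B c)]. The first part keeps the
    one-sided bound because [B] is nonnegative near [c]; the second is an increment of a
    differentiable function, whatever the sign of [A c]. *)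
Lemma upper_slopeM A B c d d' : (\forall s \near c, 0 <= B s) ->
  upper_slope A c d -> is_derive c 1 B d' ->
  upper_slope (A \* B) c (d * B c + A c * d').
Proof.
move=> B0 Ad Bd' e e0.
have Bc : B s @[s --> c] --> B c.
  by apply: differentiable_continuous; apply/derivable1_diffP; case: Bd'.
have Bc0 : 0 <= B c by exact: nbhs_singleton B0.
(* Of the tolerance [e], one quarter pays for [B c * e1], one quarter for replacing [B s] by [B c],
   and one half for the slope of [A c * B]. *)
pose e1 := e / (4 * (B c + 1)).
have e10 : 0 < e1 by rewrite divr_gt0//; lra.
have Be1 : B c * e1 <= e / 4.
  have : e1 * (B c + 1) = e / 4 by rewrite /e1; field; lra.
  by lra.
have e40 : 0 < e / 4 by rewrite divr_gt0.
have e20 : 0 < e / 2 by rewrite divr_gt0.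
have Bd : (d + e1) * B s @[s --> c] --> (d + e1) * B c.
  by apply: cvgM => //; exact: cvg_cst.
move/cvgrPdist_lt/(_ _ e40) in Bd.
have ABd : upper_slope (fun s => A c * B s) c (A c * d').
  by apply: upper_slope_derive; exact: is_deriveZ.
near=> s.
have hA : (A s - A c) * (s - c) <= (d + e1) * (s - c) ^+ 2 by near: s; exact: Ad.
have hAB : (A c * B s - A c * B c) * (s - c) <= (A c * d' + e / 2) * (s - c) ^+ 2.
  by near: s; exact: ABd.
have Bs0 : 0 <= B s by near: s.
have /ltr_normlP[hB _] : `|(d + e1) * B c - (d + e1) * B s| < e / 4 by near: s.
have h1 := ler_wpM2l Bs0 hA.
have h2 : (d + e1) * B s * (s - c) ^+ 2 <= (d * B c + e / 2) * (s - c) ^+ 2.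
  by apply: ler_wpM2r; [exact: sqr_ge0|lra].
rewrite /=; lra.
Unshelve. all: by end_near. Qed.

Lemma is_derive1_scale_id (V : normedModType R) (w : R -> V) (t : R) (dw : V) :
  is_derive t 1 w dw -> is_derive t 1 (fun s => s *: w s) (w t + t *: dw).
Proof.
move=> wd; apply/is_derive1_slope.
have ws := (is_derive1_slope _ _ _).1 wd; have wc := is_derive1_shift_cvg wd.
have cv : w (t + h) + t *: (h^-1 *: (w (t + h) - w t)) @[h --> (0 : R)^'] --> w t + t *: dw.
  by apply: cvgD => //; apply: cvgZ => //; exact: cvg_cst.
apply: cvg_trans cv; apply: near_eq_cvg; near=> h.
have h0 : h != 0 by near: h; exact: nbhs_dnbhs_neq.
have -> : (t + h) *: w (t + h) - t *: w t = h *: w (t + h) + t *: (w (t + h) - w t).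
  by rewrite scalerBr scalerDl addrA (addrC (h *: _)).
by rewrite [RHS]scalerDr !scalerA mulVf// scale1r mulrC.
Unshelve. all: by end_near. Qed.

End upper_slope_calculus.

(** * Functions whose increments are controlled by those of [v] *)

Section increment_bounded.
Context {R : realType} {U : normedModType R}.
Variables (a b : R) (v : R -> U).

(** The bounds on the values accompany the bound on the increment so that the class is stable under
    bilinear products. *)
Definition increment_bounded (V : normedModType R) (y : R -> V) : Prop :=
  exists2 C, 0 <= C & forall s t, a <= s -> s <= t -> t <= b ->
    [/\ `|y s| <= C, `|y t| <= C & `|y t - y s| <= C * (t - s + `|v t - v s|)].

Lemma increment_bounded_cst (V : normedModType R) (c : V) :
  increment_bounded (fun=> c).
Proof.
exists `|c| => // s t _ st _; split => //.
by rewrite subrr normr0 mulr_ge0// addr_ge0// subr_ge0.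
Qed.

Lemma increment_bounded_id : increment_bounded (id : R -> R).
Proof.
exists (`|a| + `|b| + 1) => [|s t as_ st tb]; first by rewrite !addr_ge0.
have := ler_norm b; have := ler_norm (- a); rewrite normrN => a1 b1.
have b0 := normr_ge0 b; have a0 := normr_ge0 a.
split; [by rewrite ler_norml; apply/andP; split; lra..|].
have r0 := normr_ge0 (v t - v s).
rewrite ger0_norm ?subr_ge0//; apply: le_trans (_ : t - s + `|v t - v s| <= _); first lra.
by rewrite ler_peMl; lra.
Qed.

Lemma increment_boundedD (V : normedModType R) (y w : R -> V) :
  increment_bounded y -> increment_bounded w ->
  increment_bounded (fun t => y t + w t).
Proof.
move=> [C C0 Cy] [D D0 Dw]; exists (C + D) => [|s t as_ st tb]; first exact: addr_ge0.
have [y1 y2 y3] := Cy _ _ as_ st tb; have [w1 w2 w3] := Dw _ _ as_ st tb.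
split; [exact: le_trans (ler_normD _ _) (lerD _ _)..|].
by rewrite mulrDl opprD addrACA; exact: le_trans (ler_normD _ _) (lerD _ _).
Qed.

Lemma increment_bounded_bilin (V1 V2 V3 : normedModType R) (op : V1 -> V2 -> V3)
    (y : R -> V1) (w : R -> V2) :
  (forall p q, `|op p q| <= `|p| * `|q|) ->
  (forall p p' q q', op p q - op p' q' = op (p - p') q + op p' (q - q')) ->
  increment_bounded y -> increment_bounded w ->
  increment_bounded (fun t => op (y t) (w t)).
Proof.
move=> opM opB [C C0 Cy] [D D0 Dw].
have CD0 : 0 <= C * D by exact: mulr_ge0.
exists (2 * (C * D)) => [|s t as_ st tb]; first by lra.
have [y1 y2 y3] := Cy _ _ as_ st tb; have [w1 w2 w3] := Dw _ _ as_ st tb.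
have CDD r : r <= C * D -> r <= 2 * (C * D) by lra.
split; [by apply: CDD; apply: le_trans (opM _ _) _; exact: ler_pM..|].
rewrite opB; apply: le_trans (ler_normD _ _) _.
set r := t - s + _ in y3 w3 *.
have : `|op (y t - y s) (w t)| <= (C * r) * D by apply: le_trans (opM _ _) _; exact: ler_pM.
have : `|op (y s) (w t - w s)| <= C * (D * r) by apply: le_trans (opM _ _) _; exact: ler_pM.
lra.
Qed.

End increment_bounded.

Lemma within_continuous_bounded (R : realType) (V : normedModType R) (a b : R) (w : R -> V) :
  a <= b -> {within `[a, b], continuous w} ->
  exists2 M, 0 <= M & forall t, a <= t -> t <= b -> `|w t| <= M.
Proof.
move=> ab cw; have [|c _ hc] := @EVT_max _ (fun t => `|w t|) a b ab.
  move=> t; apply: (@continuous_comp (subspace `[a, b]) V R w); first exact: cw.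
  exact: norm_continuous.
by exists `|w c| => // t at_ tb; apply: hc; rewrite in_itv/= at_.
Qed.

Section dot_increment_bounded.
Context {R : realType} {H : completeNormedModType R}.
Variable dot : {dot H for idfun}.
Hypothesis norm_dot : forall u : H, `|u| ^+ 2 = dot u u.

Lemma dot0r (u : H) : dot u 0 = 0.
Proof. by rewrite -(scale0r u) dotZr mul0r. Qed.

(** The vector-valued mean value inequality follows from the scalar mean value theorem for
    [dot (x r) e], where [e] is the increment [x t - x s] itself; a factor [|e|] then cancels. *)
Lemma derive_le_lipschitz (x v : R -> H) (s t M : R) : s <= t ->
  (forall c, s <= c -> c <= t -> is_derive c 1 x (v c)) ->
  (forall c, s <= c -> c <= t -> `|v c| <= M) ->
  `|x t - x s| <= M * (t - s).
Proof.
move=> st xv vM; set e := x t - x s.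
have der c : s <= c -> c <= t -> is_derive c 1 (fun r => dot (x r) e) (dot (v c) e).
  move=> sc ct; have := dot_is_derive norm_dot (xv _ sc ct) (is_derive_cst e c 1).
  by rewrite dot0r addr0.
have [c||c] := @MVT_segment _ (fun r => dot (x r) e) (fun r => dot (v r) e) s t st.
- by rewrite in_itv/= => /andP[/ltW sc /ltW ct]; exact: der.
- apply: derivable_within_continuous => c; rewrite in_itv/= => /andP[sc ct].
  by have [] := der c sc ct.
rewrite in_itv/= => /andP[sc ct].
have -> : dot (x t) e - dot (x s) e = `|e| ^+ 2 by rewrite norm_dot -dotNl -dotDl.
have [->|e0] := eqVneq e 0.
  rewrite normr0 => _; apply: mulr_ge0; last by rewrite subr_ge0.
  exact: le_trans (vM _ sc ct).
have {}e0 : 0 < `|e| by rewrite normr_gt0.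
move=> E; rewrite -(ler_pM2l e0) -expr2 E.
rewrite mulrA; apply: ler_wpM2r; first by rewrite subr_ge0.
apply: le_trans (ler_norm _) _; apply: le_trans (cauchy_schwarz norm_dot _ _) _.
by rewrite mulrC; apply: ler_wpM2l => //; exact: vM.
Qed.

End dot_increment_bounded.

(** * Bounded primitives *)

(* No measurability is assumed: the integral of a nonnegative function is a
   supremum over the simple functions below it. *)
Lemma le_integral_patch d (T : measurableType d) (R : realType)
    (m : {measure set T -> \bar R}) (D E : set T) (f g : T -> \bar R) :
  (forall x, D x -> 0 <= f x)%E -> (forall x, E x -> 0 <= g x)%E ->
  (forall x, (f \_ D) x <= (g \_ E) x)%E ->
  (\int[m]_(x in D) f x <= \int[m]_(x in E) g x)%E.
Proof.
move=> f0 g0 fg; rewrite !ge0_integralE//.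
apply: le_ereal_sup => _ [h hf <-]; exists h => // x.
exact: le_trans (hf x) (fg x).
Qed.

Lemma ae_imply2 d (T : measurableType d) (R : realType)
    (m : {measure set T -> \bar R}) (P Q W : T -> Prop) :
  (forall t, P t -> Q t -> W t) ->
  {ae m, forall t, P t} -> {ae m, forall t, Q t} -> {ae m, forall t, W t}.
Proof.
move=> PQW mP mQ; apply: (negligibleS _ (negligibleU mP mQ)) => t nW.
apply: contrapT => /not_orP[/contrapT Pt /contrapT Qt].
by apply: nW; exact: PQW.
Qed.

(* [h] lies almost everywhere below the derivative of a bounded nondecreasing
   function. *)
Definition bounded_primitive (R : realType) (a : R) (h : R -> R) : Prop :=
  exists K k : R -> R, [/\ {homo K : s t / s <= t}, exists M, forall t, K t <= M,
    forall t, 0 <= k t &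
    {ae (@lebesgue_measure R), forall t, a < t -> h t <= k t /\ is_derive t 1 K (k t)}].

(** Integrating from -oo gives a primitive that is nondecreasing on the whole line and bounded by
    the total integral; its derivative almost everywhere is Lebesgue's theorem. *)
Lemma integrable_bounded_primitive (R : realType) (k : R -> R) :
  measurable_fun setT k -> (forall t, 0 <= k t) ->
  (\int[@lebesgue_measure R]_t (k t)%:E < +oo)%E ->
  exists K : R -> R, [/\ {homo K : s t / s <= t}, exists M, forall t, K t <= M &
    {ae (@lebesgue_measure R), forall t : R, is_derive t 1 K (k t)}].
Proof.
move=> mk k0 kfin.
have mE : measurable_fun setT (EFin \o k) by exact/measurable_EFinP.
have intk : (@lebesgue_measure R).-integrable setT (EFin \o k).
  apply/integrableP; split => //; apply: le_lt_trans kfin.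
  by under eq_integral do rewrite /= ger0_norm//.
have intS (A : set R) : measurable A -> (@lebesgue_measure R).-integrable A (EFin \o k).
  by move=> mA; apply: integrableS intk.
have le_sub (A B : set R) : measurable A -> measurable B -> A `<=` B ->
    \int[@lebesgue_measure R]_(t in A) k t <= \int[@lebesgue_measure R]_(t in B) k t.
  move=> mA mB AB; apply: fine_le; try exact: integrable_fin_num (intS _ _).
  apply: ge0_subset_integral => //; first exact: measurable_funS mE.
  by move=> x _; rewrite lee_fin.
exists (fun t => \int[@lebesgue_measure R]_(u in `]-oo, t]) k u); split.
- move=> s t st; apply: le_sub => // u; rewrite /= !in_itv/= => us.
  exact: le_trans us st.
- by exists (\int[@lebesgue_measure R]_u k u) => t; apply: le_sub.
- have := @FTC1 R k -oo%O (fun y => intS _ (measurable_itv _)) (open_integrable_locally openT intk).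
  move=> dK; apply: ae_imply2 (dK) (dK) => t /(_ (ltNyr _))[dt <-] _.
  by rewrite derive1E; apply/derivableP.
Qed.

Section bounded_primitive.
Context {R : realType}.
Implicit Types h : R -> R.

(** Setting [h] to zero outside [[a, +oo[] and on [N] gives a measurable nonnegative integrand on
    the whole line. The null set [N] makes room for [t * |g t|], whose measurability is obtained off
    the set where the simple functions may fail to converge. *)
Lemma bounded_primitive_integral (a : R) h (N : set R) :
  measurable N -> @lebesgue_measure R N = 0%E ->
  measurable_fun (`[a, +oo[ `\` N) h -> (forall t, a <= t -> 0 <= h t) ->
  (\int[@lebesgue_measure R]_(t in `[a, +oo[) (h t)%:E < +oo)%E ->
  bounded_primitive a h.
Proof.
move=> mN N0 mh h0 hfin.
pose D := `[a, +oo[ `\` N.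
have mD : measurable D by exact: measurableD.
pose k := h \_ D.
have aD t : D t -> a <= t by rewrite /D/= in_itv/= andbT => -[].
have k0 t : 0 <= k t.
  by rewrite /k patchE; case: ifPn => // /set_mem/aD/h0.
have [||K [Kmono KM dK]] := @integrable_bounded_primitive R k _ k0.
- exact: (measurable_restrictT h mD).1.
- apply: le_lt_trans hfin; apply: le_integral_patch.
  + by move=> t _; rewrite lee_fin.
  + by move=> t; rewrite /= in_itv/= andbT lee_fin; exact: h0.
  + move=> t; rewrite patch_setT /k !patchE.
    case: ifPn => [/set_mem Dt|_].
      by rewrite mem_set//; case: Dt.
    by case: ifPn => // /set_mem; rewrite /= in_itv/= andbT lee_fin => /h0.
exists K, k; split => //.
have Nae : {ae (@lebesgue_measure R), forall t, ~ N t}.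
  by exists N; split => // t /= /contrapT.
apply: ae_imply2 Nae dK => t Nt dt at_; split => //.
rewrite /k patchE mem_set//; split => //.
by rewrite /= in_itv/= andbT ltW.
Qed.

Lemma bounded_primitiveD (a : R) h1 h2 :
  bounded_primitive a h1 -> bounded_primitive a h2 -> bounded_primitive a (h1 \+ h2).
Proof.
move=> [K1 [k1 [m1 [M1 KM1] p1 d1]]] [K2 [k2 [m2 [M2 KM2] p2 d2]]].
exists (K1 + K2), (k1 + k2); split.
- by move=> s t st; apply: lerD; [exact: m1|exact: m2].
- by exists (M1 + M2) => t; apply: lerD.
- by move=> t; apply: addr_ge0.
- apply: ae_imply2 d1 d2 => t d1 d2 at_.
  have [? ?] := d1 at_; have [? ?] := d2 at_.
  by split; [exact: lerD|exact: is_deriveD].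
Qed.

Lemma bounded_primitiveZ (a c : R) h : 0 <= c ->
  bounded_primitive a h -> bounded_primitive a (fun t => c * h t).
Proof.
move=> c0 [K [k [m [M KM] p d]]].
exists (c \*: K), (c \*: k); split.
- by move=> s t st; apply: ler_wpM2l => //; exact: m.
- by exists (c * M) => t; apply: ler_wpM2l.
- by move=> t; apply: mulr_ge0.
- apply: ae_imply2 (d) (d) => t dt _ at_; have [? ?] := dt at_.
  by split; [exact: ler_wpM2l|exact: is_deriveZ].
Qed.

End bounded_primitive.

Lemma vector_simple_norm_measurable (R : realType) (V : normedModType R)
    (s : R -> V) : vector_simple s -> measurable_fun setT (fun t => `|s t|).
Proof.
move=> [fs ms] _ Y mY; rewrite setTI.
rewrite (_ : _ @^-1` Y = \bigcup_(y in range s `&` [set y | Y `|y|]) (s @^-1` [set y])).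
  by apply: fin_bigcup_measurable; [exact: finite_setIl|move=> y _; exact: ms].
apply/seteqP; split => t /=; last by move=> [y [_ Yy] sty]; rewrite sty.
by move=> Yt; exists (s t) => //; split => //; exists t.
Qed.

Lemma bounded_primitive_strongly_measurable (R : realType) (V : normedModType R)
    (a : R) (g : R -> V) : 0 < a -> strongly_measurable_from a g ->
  (\int[@lebesgue_measure R]_(t in `[a, +oo[) (t * `|g t|)%:E < +oo)%E ->
  bounded_primitive a (fun t => t * `|g t|).
Proof.
move=> a0 [s ss [N [mN N0 sN]]] gfin.
apply: (bounded_primitive_integral mN N0) => //.
  apply: measurable_funM; first exact: measurable_id.
  apply: (@measurable_fun_cvg _ _ _ _ (fun n t => `|s n t|)).
    by move=> n; apply: measurable_funTS; exact: vector_simple_norm_measurable.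
  move=> t [at_ Nt]; apply: cvg_norm.
  apply: contrapT => h; apply: Nt; apply: sN => /= sg; apply: h; apply: sg.
  by move: at_; rewrite /= in_itv/= andbT.
by move=> t at_; rewrite mulr_ge0// (le_trans (ltW a0)).
Qed.

Lemma bounded_primitive_continuous (R : realType) (a : R) (h : R -> R) :
  {within `[a, +oo[, continuous h} -> (forall t, a <= t -> 0 <= h t) ->
  (\int[@lebesgue_measure R]_(t in `[a, +oo[) (h t)%:E < +oo)%E ->
  bounded_primitive a h.
Proof.
move=> ch h0; apply: (bounded_primitive_integral measurable0 (measure0 _)) => //.
by rewrite setD0; exact: subspace_continuous_measurable_fun.
Qed.

(** * Limits at infinity *)

Lemma nonincreasing_cvg_pinfty (R : realType) (a : R) (psi : R -> R) :
  (forall s t, a < s -> s <= t -> psi t <= psi s) ->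
  (forall t, a < t -> 0 <= psi t) ->
  exists l : R, psi t @[t --> +oo] --> l.
Proof.
(* Truncating the argument at [a + 1] extends the monotonicity to all of [R] without changing the
   behaviour at infinity. *)
move=> psi_mono psi0; pose F t := - psi (Num.max t (a + 1)).
have a1 t : a < Num.max t (a + 1) by rewrite lt_max ltrDl ltr01 orbT.
have Fmono : {homo F : s t / s <= t}.
  move=> s t st; rewrite lerN2; apply: psi_mono => //.
  by rewrite ge_max !le_max lexx st/= orbT.
have Fub : has_ubound (range F).
  by exists 0 => _ [t _ <-]; rewrite oppr_le0; exact: psi0.
exists (- sup (range F)).
have cF : - F t @[t --> +oo] --> - sup (range F).
  by apply: cvgN; exact: nondecreasing_cvgr.
apply: cvg_trans cF; apply: near_eq_cvg; near=> t.
have ta : a + 1 <= t by near: t; apply: nbhs_pinfty_ge; rewrite num_real.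
by rewrite /= /F opprK max_l.
Unshelve. all: by end_near. Qed.

(** * Asymptotics of the Euler expression [t * dh t + c * h t] *)

Section euler_ode.
Context {R : realType}.
Variables (a c : R) (h dh : R -> R).
Hypothesis c_ge1 : 1 <= c.
Hypothesis dhP : forall t : R, a < t -> is_derive t 1 h (dh t).

(* [t ^ c] is an integrating factor: the derivative of [t ^ c * (h t - m / c)] is
   [t ^ (c - 1) * (t * dh t + c * h t - m)]. *)
Lemma euler_ode_le (m e : R) : 0 < e ->
  (\forall t \near +oo, t * dh t + c * h t <= m) ->
  \forall t \near +oo, h t <= m / c + e.
Proof.
move=> e0 [T0 [_ mT0]].
have c0 : 0 < c by exact: lt_le_trans ltr01 c_ge1.
pose T := Num.max (Num.max (T0 + 1) (a + 1)) 1.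
have [TT0 Ta T1] : [/\ T0 < T, a < T & 1 <= T].
  rewrite /T !lt_max le_max !ltrDl !ltr01 lexx !orbT; split => //.
pose phi t := (t `^ c) * (h t - m / c).
have dphi t : T <= t -> is_derive t 1 phi
    ((t `^ c) * dh t + (h t - m / c) * (c * t `^ (c - 1))).
  move=> Tt; have t0 : 0 < t by lra.
  have hd : is_derive t 1 (fun s => h s - m / c) (dh t).
    have at_ : a < t by lra.
    by have := is_deriveB (dhP at_) (is_derive_cst (m / c) t 1); rewrite subr0.
  exact: is_deriveM (is_derive1_powR c t0) hd.
have phi_le t : T <= t -> phi t <= phi T.
  move=> Tt; have [s||s] := @MVT_segment _ phi (fun t => (t `^ c) * dh t + (h t - m / c) * (c * t `^ (c - 1))) T t Tt.
  - by rewrite in_itv/= => /andP[/ltW Ts _]; exact: dphi.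
  - apply: derivable_within_continuous => s; rewrite in_itv/= => /andP[Ts _].
    by have [] := dphi s Ts.
  rewrite in_itv/= => /andP[Ts _] E; rewrite -subr_le0 E.
  apply: mulr_le0_ge0; last by rewrite subr_ge0.
  have s0 : 0 < s by lra.
  have -> : s `^ c = s * s `^ (c - 1).
    by rewrite -{2}(powRr1 (ltW s0)) -powRD ?(gt_eqF s0) ?implybT// addrC subrK.
  have -> : s * s `^ (c - 1) * dh s + (h s - m / c) * (c * s `^ (c - 1)) =
      s `^ (c - 1) * (s * dh s + c * h s - m) by field; rewrite gt_eqF.
  apply: mulr_ge0_le0; first exact: powR_ge0.
  by rewrite subr_le0; apply: mT0; lra.
near=> t.
have Tt : T <= t by near: t; apply: nbhs_pinfty_ge; rewrite num_real.
have Pt : `|phi T| / e <= t by near: t; apply: nbhs_pinfty_ge; rewrite num_real.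
have t1 : 1 <= t by lra.
(* Since [c >= 1], the bound on [phi] gives [h t - m / c <= |phi T| / t] when the left side is
   positive, and this is at most [e] by the choice of [t]. *)
have tc : t <= t `^ c by rewrite -{1}(powRr1 (a := t)) ?ler_powR//; lra.
rewrite -lerBlDl.
have := phi_le t Tt; rewrite /phi => pt.
have [hneg|hpos] := leP (h t - m / c) 0; first by lra.
have : t * (h t - m / c) <= `|phi T|.
  apply: le_trans (_ : t `^ c * (h t - m / c) <= _); first by apply: ler_wpM2r => //; exact: ltW.
  exact: le_trans pt (ler_norm _).
move: Pt; rewrite ler_pdivrMr// => Pt tp.
have : t * (h t - m / c) <= t * e by exact: le_trans tp Pt.
by rewrite ler_pM2l//; lra.
Unshelve. all: by end_near. Qed.

End euler_ode.

Lemma euler_ode_cvg (R : realType) (a c l : R) (h dh : R -> R) : 1 <= c ->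
  (forall t : R, a < t -> is_derive t 1 h (dh t)) ->
  t * dh t + c * h t @[t --> +oo] --> l -> h t @[t --> +oo] --> l / c.
Proof.
move=> c1 dhP lc; have c0 : 0 < c by exact: lt_le_trans ltr01 c1.
have dNhP (t : R) : a < t -> is_derive t 1 (fun t => - h t) (- dh t).
  by move=> /dhP ?; exact: is_deriveN.
apply/cvgrPdist_le => e e0; have e20 : 0 < e / 2 by rewrite divr_gt0.
have ce0 : 0 < c * (e / 2) by rewrite mulr_gt0.
move/cvgrPdist_le : lc => /(_ _ ce0) lc.
have up : \forall t \near +oo, h t <= (l + c * (e / 2)) / c + e / 2.
  by apply: (euler_ode_le c1 dhP e20); apply: filterS lc => t /ler_normlP[]; lra.
have dn : \forall t \near +oo, - h t <= (- l + c * (e / 2)) / c + e / 2.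
  by apply: (euler_ode_le c1 dNhP e20); apply: filterS lc => t /ler_normlP[]; lra.
have E1 : (l + c * (e / 2)) / c = l / c + e / 2 by field; rewrite gt_eqF.
have E2 : (- l + c * (e / 2)) / c = - (l / c) + e / 2 by field; rewrite gt_eqF.
rewrite E1 in up; rewrite E2 in dn.
by apply: filterS2 up dn => t h1 h2; rewrite ler_norml; apply/andP; split; lra.
Qed.

(** * The energy of a trajectory *)

Section trajectory.
Context {R : realType} {H : completeNormedModType R}.
Variable dot : {dot H for idfun}.
Hypothesis norm_dot : forall u : H, `|u| ^+ 2 = dot u u.
Variables (f : H -> R) (ft : H -> R -> R).
Hypothesis fts : smoothing_function dot f ft.
Variables kappa : R.
Hypothesis kappaP : forall x (mu : R), 0 < mu -> `|(ft x)^`()%classic mu| <= kappa.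
Variables (alpha t0 : R) (mu dmu : R -> R) (x v : R -> H).
Hypotheses (t0_gt0 : 0 < t0) (alpha_gt3 : 3 < alpha).
Hypothesis mu_gt0 : forall t : R, 0 <= t -> 0 < mu t.
Hypothesis mu_C1 : C1_from 0 mu dmu.
Hypothesis mu_decreasing : forall s t : R, 0 <= s -> s < t -> mu t < mu s.
Hypothesis xv : C1_from t0 x v.
Hypothesis v_ac : locally_absolutely_continuous_from t0 v.

Let kappa_ge0 : 0 <= kappa.
Proof. by apply: le_trans (kappaP 0 ltr01). Qed.

Let mu_le (s t : R) : 0 <= s -> s <= t -> mu t <= mu s.
Proof.
by move=> s0; rewrite le_eqVlt => /predU1P[->//|/(mu_decreasing s0)/ltW].
Qed.

(* [D m] stands for the gradient of [ft^~ m]: unification may diverge on terms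
   that contain [grad]. *)
Variable D : R -> H -> H.
Hypothesis D_le : forall m y w, 0 < m -> ft y m + dot (D m y) (w - y) <= ft w m.
Hypothesis D_continuous : forall m, 0 < m -> continuous (D m).
Hypothesis D_param_continuous : forall y m, 0 < m -> {for m, continuous (D^~ y)}.
Variable L : R.
Hypothesis L_ge0 : 0 <= L.
Hypothesis D_lipschitz : forall m y w, 0 < m -> `|D m y - D m w| <= L / m * `|y - w|.

(** * The energy for a fixed minimiser and a fixed parameter [l] *)

Section energy.
Variable z : H.
Hypothesis z_argmin : argmin f z.

(** The correction [kappa * mu t] compensates the smoothing error, which makes the gap nonnegative,
    and turns the dependence on [mu] into a monotone one. *)
Definition gap (t : R) : R := ft (x t) (mu t) + kappa * mu t - f z.

Lemma gap_ge0 (t : R) : 0 <= t -> 0 <= gap t.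
Proof.
move=> /mu_gt0 mt; have := smoothing_le fts kappaP (x t) mt.
by have := z_argmin (x t); rewrite /gap; lra.
Qed.

(* [ft + kappa * mu] is nondecreasing in [mu], so only the increment of [x]
   matters: [gap] need not be differentiated. *)
Lemma gap_increment (s t : R) : 0 <= s -> s <= t ->
  gap t - gap s <= dot (D (mu s) (x t)) (x t - x s).
Proof.
move=> s0 st; have mt := mu_gt0 (le_trans s0 st); have ms := mu_gt0 s0.
have := smoothing_param_mono fts kappaP (x t) mt (mu_le s0 st).
have := D_le (x t) (x s) ms.
by rewrite -(opprB (x t)) dotNr /gap; lra.
Qed.

(** [gap_increment] takes [mu] at the earlier time and [x] at the later one. For [h > 0] this gives
    [D (mu c) (x (c + h))], for [h < 0] it gives [D (mu (c + h)) (x c)]: only one argument moves in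
    each case, and separate continuity of [D] yields both limits. *)
Lemma gap_slope (c : R) : t0 < c -> upper_slope gap c (dot (D (mu c) (x c)) (v c)).
Proof.
move=> t0c; have c0 : 0 < c by exact: lt_trans t0c.
have dx := C1_from_derive xv t0c.
have xs := (is_derive1_slope _ _ _).1 dx.
have xc := is_derive1_shift_cvg dx.
have muc := is_derive1_shift_cvg (C1_from_derive mu_C1 c0).
have cgrad := D_continuous (mu_gt0 (ltW c0)).
have cgrad_mu := @D_param_continuous (x c) (mu c) (mu_gt0 (ltW c0)).
have lim1 : dot (D (mu c) (x (c + h))) (h^-1 *: (x (c + h) - x c))
    @[h --> (0 : R)^'] --> dot (D (mu c) (x c)) (v c).
  by apply: (dot_cvg norm_dot) => //; exact: (continuous_cvg _ (cgrad (x c)) xc).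
have lim2 : dot (D (mu (c + h)) (x c)) (h^-1 *: (x (c + h) - x c))
    @[h --> (0 : R)^'] --> dot (D (mu c) (x c)) (v c).
  by apply: (dot_cvg norm_dot) => //; exact: (continuous_cvg _ cgrad_mu muc).
apply: upper_slope_dnbhs => e e0.
move/cvgrPdist_lt/(_ _ e0) in lim1; move/cvgrPdist_lt/(_ _ e0) in lim2.
near=> h.
have h_neq0 : h != 0 by near: h; exact: nbhs_dnbhs_neq.
have /ltr_normlP[l1 _] : `|dot (D (mu c) (x c)) (v c) -
  dot (D (mu c) (x (c + h))) (h^-1 *: (x (c + h) - x c))| < e.
  by near: h; exact: lim1.
have /ltr_normlP[l2 _] : `|dot (D (mu c) (x c)) (v c) -
  dot (D (mu (c + h)) (x c)) (h^-1 *: (x (c + h) - x c))| < e.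
  by near: h; exact: lim2.
have h2 : 0 < h ^+ 2 by rewrite exprn_even_gt0.
have /ltr_normlP[ch0 _] : `|h| < c by near: h; exact: dnbhs0_lt.
have scale1 w : dot w (x (c + h) - x c) * h = dot w (h^-1 *: (x (c + h) - x c)) * h ^+ 2.
  by rewrite dotZr expr2; field.
have [h0|h0] := ltP 0 h.
  have cch : c <= c + h by lra.
  have := gap_increment (ltW c0) cch.
  rewrite -(ler_pM2r h0) scale1 => /le_trans; apply.
  by apply: ler_wpM2r; [exact: ltW|move: l1; lra].
have h0' : 0 < - h by rewrite oppr_gt0 lt_neqAle h_neq0.
have [chc ch] : c + h <= c /\ 0 <= c + h by split; lra.
have := gap_increment ch chc.
rewrite -(ler_pM2r h0') -(opprB (x (c + h))) dotNr mulrNN scale1 => gi.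
rewrite -mulrNN opprB; apply: le_trans gi _.
by apply: ler_wpM2r; [exact: ltW|move: l2; lra].
Unshelve. all: by end_near. Qed.

Variable l : R.
Hypotheses (l_ge2 : (2 : R) <= l) (l_le : l <= alpha - 1 :> R).

Definition velocity_mix (t : R) : H := l *: (x t - z) + t *: v t.

Definition energy (t : R) : R :=
  gap t * (t * t) + (2^-1 * dot (velocity_mix t) (velocity_mix t) +
    l * (alpha - 1 - l) / 2 * dot (x t - z) (x t - z)).

Lemma energy_ge (t : R) : 0 <= t -> `|velocity_mix t| ^+ 2 / 2 <= energy t.
Proof.
move=> /gap_ge0 gt; rewrite /energy -!norm_dot.
have h1 : 0 <= gap t * (t * t) by apply: mulr_ge0 => //; exact: sqr_ge0.
have h2 : 0 <= l * (alpha - 1 - l) * `|x t - z| ^+ 2.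
  by rewrite !mulr_ge0// ?subr_ge0// (le_trans _ l_ge2).
lra.
Qed.

(** After substituting c a = c g - alpha v - c D, the two terms c^2 <D, v> cancel, and the
    coefficient l (alpha - 1 - l) is the one that cancels <v, x - z>. Convexity bounds <D, x - z>
    below by gap - 2 kappa mu. What is left are the nonpositive terms -(l - 2) c gap and -(alpha - 1
    - l) c |v|^2, and the terms in g and mu collected in [k]. *)
Lemma energy_slope (c : R) (a g : H) (k : R) : t0 < c -> is_derive c 1 v a ->
  a + (alpha / c) *: v c + D (mu c) (x c) = g ->
  c * `|g| + 2 * l * kappa * (c * mu c) <= k ->
  upper_slope energy c (k * (1 + energy c)).
Proof.
move=> t0c va eqn kP; have c0 : 0 < c by exact: lt_trans t0c.
have xd := C1_from_derive xv t0c.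
have xzd : is_derive c 1 (fun t => x t - z) (v c).
  by have := is_deriveB xd (is_derive_cst z c 1); rewrite subr0.
have Wd : is_derive c 1 velocity_mix (l *: v c + (v c + c *: a)).
  exact: is_deriveD (is_deriveZ l xzd) (is_derive1_scale_id va).
set w := velocity_mix c; set d := D (mu c) (x c) in eqn *.
have quad : is_derive c 1 (fun t => 2^-1 * dot (velocity_mix t) (velocity_mix t) +
    l * (alpha - 1 - l) / 2 * dot (x t - z) (x t - z))
   (dot (l *: v c + (v c + c *: a)) w + l * (alpha - 1 - l) * dot (v c) (x c - z)).
  apply: is_derive_eq (is_deriveD (is_deriveZ 2^-1 (dot_is_derive norm_dot Wd Wd))
    (is_deriveZ (l * (alpha - 1 - l) / 2) (dot_is_derive norm_dot xzd xzd))) _.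
  rewrite /GRing.scale/= (dotC dot (velocity_mix c)) (dotC dot (x c - z)) -/w.
  by field.
have sq : is_derive c 1 (fun t : R => t * t) (c + c).
  apply: is_derive_eq (is_deriveM (is_derive_id c 1) (is_derive_id c 1)) _.
  by rewrite /GRing.scale/= mulr1.
have sq0 : \forall s \near c, 0 <= s * s by apply: (@filterE _ (nbhs c)) => s; exact: sqr_ge0.
have := upper_slopeD (upper_slopeM sq0 (gap_slope t0c) sq) (upper_slope_derive quad).
apply: upper_slope_le; rewrite -/d.
have conv : gap c - 2 * (kappa * mu c) <= dot d (x c - z).
  have mc := mu_gt0 (ltW c0).
  have := D_le (x c) z mc.
  have := smoothing_ge fts kappaP z mc.
  by rewrite -(opprB (x c)) dotNr /gap -/d; lra.
have ca : c *: a = c *: g - alpha *: v c - c *: d.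
  rewrite -eqn !scalerDr scalerA mulrCA divff ?gt_eqF// mulr1.
  by rewrite [RHS]addrAC !addrK.
have gap0 := gap_ge0 (ltW c0).
have wE : `|w| ^+ 2 / 2 <= energy c := energy_ge (ltW c0).
have E0 : 0 <= energy c by apply: le_trans wE; rewrite divr_ge0// sqr_ge0.
have gw : c * dot g w <= c * `|g| * (1 + energy c).
  rewrite -mulrA; apply: ler_wpM2l; first exact: ltW.
  apply: le_trans (ler_norm _) _; apply: le_trans (cauchy_schwarz norm_dot _ _) _.
  apply: ler_wpM2l => //; have := sqr_ge0 (`|w| - 1); move: wE; rewrite !expr2; lra.
have E1 : 0 <= 1 + energy c by lra.
have k1 := ler_wpM2r E1 kP.
have l2 : (2 : R) <= l := l_ge2.
have la : (l : R) <= alpha - 1 := l_le.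
have h1 : 0 <= (l - 2) * (c * gap c).
  by apply: mulr_ge0; [lra|apply: mulr_ge0 => //; exact: ltW].
have h2 : 0 <= (alpha - 1 - l) * (c * dot (v c) (v c)).
  apply: mulr_ge0; first lra.
  by apply: mulr_ge0; [exact: ltW|rewrite -norm_dot sqr_ge0].
have lc0 : 0 <= l * c by apply: mulr_ge0; [lra|exact: ltW].
have h3 := ler_wpM2l lc0 conv.
(* The term in [mu] carries no energy factor; adding this nonnegative quantity completes it to a
   multiple of [1 + energy c]. *)
have h4 : 0 <= l * c * (kappa * mu c) * energy c.
  by apply: mulr_ge0 => //; apply: mulr_ge0 => //; apply: mulr_ge0 => //; exact/ltW/mu_gt0/ltW.
rewrite ca !dotDl !dotNl !dotZl.
have -> : dot (v c) w = l * dot (v c) (x c - z) + c * dot (v c) (v c).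
  by rewrite dotDr !dotZr.
have -> : dot d w = l * dot d (x c - z) + c * dot d (v c) by rewrite dotDr !dotZr.
lra.
Qed.

Lemma v_bounded (a b : R) : t0 < a -> a <= b ->
  exists2 M, 0 <= M & forall t, a <= t -> t <= b -> `|v t| <= M.
Proof.
move=> t0a ab; apply: within_continuous_bounded => //.
apply: continuous_subspaceW (C1_from_continuous xv) => t /=.
by rewrite !in_itv/= andbT => /andP[+ _]; apply: le_trans; exact: ltW.
Qed.

Lemma x_lipschitz (a b M s t : R) : t0 < a ->
  (forall t, a <= t -> t <= b -> `|v t| <= M) ->
  a <= s -> s <= t -> t <= b -> `|x t - x s| <= M * (t - s).
Proof.
move=> t0a vM as_ st tb; apply: (derive_le_lipschitz norm_dot (v := v) st) => c sc ct.
  by apply: (C1_from_derive xv); lra.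
by apply: vM; lra.
Qed.

(** A uniform bound on [D (mu s) (x t)] is required although both arguments vary. It comes from
    continuity in [mu] at the fixed point [x a], plus the Lipschitz constant in space, which is at
    most [L / mu b] because [mu] decreases. *)
Lemma gap_increment_bounded (a b : R) : t0 < a -> a <= b -> exists2 C, 0 <= C &
  forall s t, a <= s -> s <= t -> t <= b ->
    gap t - gap s <= C * (t - s).
Proof.
move=> t0a ab; have a0 : 0 < a by exact: lt_trans t0a.
have [M M0 vM] := v_bounded t0a ab.
have cgrad : {within `[a, b], continuous (fun t => D (mu t) (x a))}.
  apply: continuous_in_subspaceT => t /set_mem; rewrite /= in_itv/= => /andP[at_ tb].
  have t_gt0 := lt_le_trans a0 at_.
  apply: (@continuous_comp R R H mu (D^~ (x a))); last exact: (@D_param_continuous (x a) (mu t) (mu_gt0 (ltW t_gt0))).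
  by apply: differentiable_continuous; apply/derivable1_diffP; case: (C1_from_derive mu_C1 t_gt0).
have [G G0 gG] := within_continuous_bounded ab cgrad.
have mb : 0 < mu b by apply: mu_gt0; lra.
have Lb0 : 0 <= L / mu b by apply: divr_ge0 => //; exact: ltW.
have ba0 : 0 <= b - a by rewrite subr_ge0.
have C0 : 0 <= G + L / mu b * (M * (b - a)).
  by apply: addr_ge0 => //; apply: mulr_ge0 => //; exact: mulr_ge0.
exists ((G + L / mu b * (M * (b - a))) * M) => [|s t as_ st tb]; first exact: mulr_ge0.
have s0 : 0 <= s by lra.
apply: le_trans (gap_increment s0 st) _.
apply: le_trans (ler_norm _) _; apply: le_trans (cauchy_schwarz norm_dot _ _) _.
have xst := x_lipschitz t0a vM as_ st tb.
rewrite -[leRHS]mulrA; apply: ler_pM => //.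
have at_ := le_trans as_ st; have sb := le_trans st tb.
rewrite -(subrK (D (mu s) (x a)) (D (mu s) (x t))).
apply: le_trans (ler_normD _ _) _; rewrite addrC; apply: lerD; first exact: gG.
have ms : mu b <= mu s by exact: mu_le.
have ms0 : 0 < mu s by exact: lt_le_trans ms.
apply: le_trans (D_lipschitz _ _ ms0) _.
apply: ler_pM => //.
- by apply: divr_ge0 => //; exact: ltW.
- by apply: ler_wpM2l => //; rewrite lef_pV2.
apply: le_trans (x_lipschitz t0a vM (lexx a) at_ tb) _.
by apply: ler_wpM2l => //; rewrite lerD2r.
Qed.

(** The bound is one-sided because the gap has only upper increments; the quadratic terms are
    [increment_bounded]. This is the form that [ac_nonincreasing] asks for. *)
Lemma energy_increment (a b : R) : t0 < a -> a <= b -> exists2 C, 0 <= C &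
  forall s t, a <= s -> s <= t -> t <= b ->
    energy t - energy s <= C * (t - s + `|v t - v s|).
Proof.
move=> t0a ab; have a0 : 0 < a by exact: lt_trans t0a.
have ba0 : 0 <= b - a by rewrite subr_ge0.
have [M M0 vM] := v_bounded t0a ab.
have Mba : 0 <= M * (b - a) by exact: mulr_ge0.
have v_ib : increment_bounded a b v v.
  exists (M + 1) => [|s t as_ st tb]; first lra.
  have := vM _ as_ (le_trans st tb); have := vM _ (le_trans as_ st) tb.
  split; [lra|lra|].
  have r0 : 0 <= t - s + `|v t - v s| by rewrite addr_ge0// subr_ge0.
  by have := mulr_ge0 M0 r0; lra.
have xz_ib : increment_bounded a b v (fun t => x t - z).
  exists (`|x a - z| + M * (b - a) + M) => [|s t as_ st tb]; first by rewrite !addr_ge0.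
  have bnd u : a <= u -> u <= b -> `|x u - z| <= `|x a - z| + M * (b - a) + M.
    move=> au ub; have -> : x u - z = x a - z + (x u - x a) by rewrite [RHS]addrC addrA subrK.
    apply: le_trans (ler_normD _ _) _.
    have := x_lipschitz t0a vM (lexx a) au ub.
    have uba : u - a <= b - a by rewrite lerD2r.
    by have := ler_wpM2l M0 uba; lra.
  split; [apply: bnd; lra|apply: bnd; lra|].
  have -> : x t - z - (x s - z) = x t - x s by rewrite opprB addrA subrK.
  apply: le_trans (x_lipschitz t0a vM as_ st tb) _.
  have ts0 : 0 <= t - s by rewrite subr_ge0.
  by apply: ler_pM => //; have := normr_ge0 (x a - z); have := normr_ge0 (v t - v s); lra.
have scale_ib (V : normedModType R) (q : R -> R) (y : R -> V) :
    increment_bounded a b v q -> increment_bounded a b v y ->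
    increment_bounded a b v (fun t => q t *: y t).
  apply: increment_bounded_bilin => [p p'|p p' q0 q1]; first by rewrite normrZ.
  by rewrite scalerBl scalerBr addrA subrK.
have dot_ib (y : R -> H) : increment_bounded a b v y ->
    increment_bounded a b v (fun t => dot (y t) (y t)).
  move=> yib; apply: (@increment_bounded_bilin _ _ _ _ _ _ _ _ dot) => //.
    exact: cauchy_schwarz.
  by move=> p p' q q'; rewrite !dotE; lra.
have W_ib : increment_bounded a b v velocity_mix.
  apply: increment_boundedD; apply: scale_ib => //.
    exact: increment_bounded_cst.
  exact: increment_bounded_id.
have [Q Q0 Qib] : increment_bounded a b v (fun t =>
    2^-1 * dot (velocity_mix t) (velocity_mix t) +
    l * (alpha - 1 - l) / 2 * dot (x t - z) (x t - z)).
  by apply: increment_boundedD; apply: (@scale_ib R) (dot_ib _ _) => //; exact: increment_bounded_cst.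
have [C C0 gapC] := gap_increment_bounded t0a ab.
have gapB s : a <= s -> s <= b -> gap s <= gap a + C * (b - a).
  move=> as_ sb; have := gapC _ _ (lexx a) as_ sb.
  have sba : s - a <= b - a by rewrite lerD2r.
  by have := ler_wpM2l C0 sba; lra.
have B0 : 0 <= gap a + C * (b - a).
  by apply: addr_ge0; [exact/gap_ge0/ltW|exact: mulr_ge0].
have b0 : 0 <= b by lra.
(* The gap part is [(gap t - gap s) * t^2 + gap s * (t + s) * (t - s)], with [t^2 <= b^2] and
   [t + s <= 2 * b]; [Q] serves the quadratic terms. *)
exists (b * b * C + 2 * b * (gap a + C * (b - a)) + Q) => [|s t as_ st tb].
  by rewrite !addr_ge0// !mulr_ge0.
have [_ _ /ler_normlP[_ q]] := Qib _ _ as_ st tb.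
have r0 := normr_ge0 (v t - v s); set r := `|v t - v s| in r0 q *.
have ts0 : 0 <= t - s by rewrite subr_ge0.
have s0 : 0 <= s by lra.
have t_ge0 : 0 <= t by lra.
have g1 : (gap t - gap s) * (t * t) <= b * b * C * (t - s).
  apply: le_trans (ler_wpM2r _ (gapC _ _ as_ st tb)) _; first exact: sqr_ge0.
  rewrite mulrC mulrA; apply: ler_wpM2r => //; apply: ler_wpM2r => //.
  by apply: ler_pM; lra.
have g2 : gap s * (t * t - s * s) <= 2 * b * (gap a + C * (b - a)) * (t - s).
  have -> : t * t - s * s = (t + s) * (t - s) by ring.
  rewrite mulrA; apply: ler_wpM2r => //; rewrite mulrC.
  by apply: ler_pM => //; [lra|exact: gap_ge0|lra|apply: gapB; lra].
have g3 : 0 <= (b * b * C + 2 * b * (gap a + C * (b - a))) * r.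
  by apply: mulr_ge0 => //; apply: addr_ge0; rewrite !mulr_ge0.
rewrite /energy; lra.
Qed.

Lemma energy_cvg (g : R -> H) :
  {ae (@lebesgue_measure R), forall t, t0 <= t -> derivable v t 1 /\
    v^`()%classic t + (alpha / t) *: v t + D (mu t) (x t) = g t} ->
  bounded_primitive t0 (fun t => t * `|g t| + 2 * l * kappa * (t * mu t)) ->
  exists e : R, energy t @[t --> +oo] --> e.
Proof.
move=> ode [K [k [Kmono [M KM] k0 dK]]].
pose psi t := (1 + energy t) * expR (- K t).
have E0 (t : R) : t0 < t -> 0 <= energy t.
  move=> t0t; apply: le_trans (energy_ge _); last by apply/ltW; exact: lt_trans t0t.
  by rewrite divr_ge0// sqr_ge0.
have psi_mono (a b : R) : t0 < a -> a <= b -> psi b <= psi a.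
  move=> t0a ab; have [C C0 incr] := energy_increment t0a ab.
  (* The increment of [psi] is that of [energy] times [expR (- K t)], at most [expR (- K a)], plus
     [1 + energy s] times the increment of [expR (- K)], which is nonpositive because [K] is
     nondecreasing. *)
  apply: (@ac_nonincreasing _ _ v psi a b (C * expR (- K a)) ab).
  - move=> eps /(v_ac (le_trans (ltW t0a) ab))[delta delta0 vd].
    exists delta => // n p q pq disj len; apply: vd => // i.
    by have [? ?] := pq i; split => //; lra.
  - move=> s t as_ st tb.
    have Kst : expR (- K t) <= expR (- K s) by rewrite ler_expR lerN2; exact: Kmono.
    have Kat : expR (- K t) <= expR (- K a).
      by rewrite ler_expR lerN2; apply: Kmono; exact: le_trans st.
    have Es : 0 <= 1 + energy s by have := E0 s; lra.
    have h1 := ler_wpM2l Es Kst.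
    have h2 := ler_wpM2r (expR_ge0 (- K t)) (incr _ _ as_ st tb).
    have r0 : 0 <= C * (t - s + `|v t - v s|) by rewrite mulr_ge0// addr_ge0// subr_ge0.
    have h3 := ler_wpM2l r0 Kat.
    rewrite /psi; lra.
  - apply: ae_imply2 ode dK => t tode dKt at_ tb.
    have t0t : t0 < t by exact: lt_le_trans at_.
    have [dv eqn] := tode (ltW t0t); have [kt Kd] := dKt t0t.
    have vd : is_derive t 1 v (v^`()%classic t) by rewrite derive1E; apply/derivableP.
    have slopeE := energy_slope t0t vd eqn kt.
    have slope1E : upper_slope (fun s => 1 + energy s) t (k t * (1 + energy t)).
      by move=> e e0; apply: filterS (slopeE e e0) => s; rewrite (_ : 1 + energy s - (1 + energy t) = energy s - energy t)//; ring.
    have expd : is_derive t 1 (fun s => expR (- K s)) (expR (- K t) * (- k t)).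
      exact: is_derive1_comp (is_derive_expR _) (is_deriveN Kd).
    have exp0 : \forall s \near t, 0 <= expR (- K s).
      by apply: (@filterE _ (nbhs t)) => s; exact: expR_ge0.
    apply: upper_slope_le (upper_slopeM exp0 slope1E expd); lra.
have [p psip] : exists p : R, psi t @[t --> +oo] --> p.
  apply: (@nonincreasing_cvg_pinfty _ t0) => [s t t0s st|t t0t]; first exact: psi_mono.
  by apply: mulr_ge0; [have := E0 _ t0t; lra|exact: expR_ge0].
(* [K] is nondecreasing and bounded, so it has a limit, and multiplying [psi] by [expR (K t)]
   recovers the energy. *)
have Kcvg : K t @[t --> +oo] --> sup (range K).
  by apply: nondecreasing_cvgr => //; exists M => _ [t _ <-].
exists (p * expR (sup (range K)) - 1).
have -> : energy = fun t => psi t * expR (K t) - 1.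
  by apply/funext => t; rewrite /psi -mulrA -expRD addNr expR0 mulr1 addrAC subrr add0r.
apply: cvgB; last exact: cvg_cst.
by apply: cvgM => //; apply: continuous_cvg => //; exact: continuous_expR.
Qed.

End energy.

(** * Convergence of distances and values, and weak limit points *)

Variable g : R -> H.
Hypothesis ode : {ae (@lebesgue_measure R), forall t, t0 <= t -> derivable v t 1 /\
  v^`()%classic t + (alpha / t) *: v t + D (mu t) (x t) = g t}.
Hypothesis g_primitive : bounded_primitive t0 (fun t => t * `|g t|).
Hypothesis mu_primitive : bounded_primitive t0 (fun t => t * mu t).

Lemma trajectory_energy_cvg z l : argmin f z -> 2 <= l -> l <= alpha - 1 ->
  exists e : R, energy z l t @[t --> +oo] --> e.
Proof.
move=> zmin l2 la; apply: (energy_cvg zmin l2 la ode).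
apply: (bounded_primitiveD g_primitive (bounded_primitiveZ _ mu_primitive)).
by apply: mulr_ge0 => //; apply: mulr_ge0 => //; exact: le_trans l2.
Qed.

(* [energy z (alpha - 1) - energy z 2] is [alpha - 3] times the left-hand side of
   the Euler equation satisfied by [|x t - z|^2 / 2]. *)
Lemma norm_sub_cvg z : argmin f z ->
  exists e : R, `|x t - z| ^+ 2 @[t --> +oo] --> e.
Proof.
move=> zmin; have alpha2 : 2 <= alpha - 1 by have := alpha_gt3; lra.
have [e1 E1] := trajectory_energy_cvg zmin alpha2 (lexx _).
have [e2 E2] := trajectory_energy_cvg zmin (lexx 2) alpha2.
pose h t := 2^-1 * dot (x t - z) (x t - z).
have dh t : t0 < t -> is_derive t 1 h (dot (v t) (x t - z)).
  move=> t0t; have xd : is_derive t 1 (fun s => x s - z) (v t).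
    by have := is_deriveB (C1_from_derive xv t0t) (is_derive_cst z t 1); rewrite subr0.
  apply: is_derive_eq (is_deriveZ 2^-1 (dot_is_derive norm_dot xd xd)) _.
  by rewrite /GRing.scale/= (dotC dot (x t - z)); field.
have qc : t * dot (v t) (x t - z) + (alpha - 1) * h t @[t --> +oo] -->
    (alpha - 3)^-1 * (e1 - e2).
  have alpha3 : alpha - 3 != 0 by rewrite gt_eqF// subr_gt0.
  have -> : (fun t => t * dot (v t) (x t - z) + (alpha - 1) * h t) =
      (fun t => (alpha - 3)^-1 * (energy z (alpha - 1) t - energy z 2 t)).
    apply/funext => t; apply: (mulfI alpha3); rewrite mulVKf//.
    rewrite /energy /velocity_mix /h; move: (x t - z) => w.
    by rewrite !dotDl !dotDr !dotZl !dotZr (dotC dot w (v t)); field.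
  by apply: cvgM; [exact: cvg_cst|exact: cvgB].
have alpha1 : 1 <= alpha - 1 by have := alpha2; lra.
have hc := euler_ode_cvg alpha1 dh qc.
exists (2 * ((alpha - 3)^-1 * (e1 - e2) / (alpha - 1))).
have -> : (fun t => `|x t - z| ^+ 2) = (fun t => 2 * h t).
  by apply/funext => t; rewrite /h norm_dot; field.
by apply: cvgM; [exact: cvg_cst|].
Qed.

Lemma gap_near_le z e : argmin f z -> 0 < e -> \forall t \near +oo, gap z t <= e.
Proof.
move=> zmin e0; have alpha2 : 2 <= alpha - 1 by have := alpha_gt3; lra.
have [r Er] := trajectory_energy_cvg zmin (lexx 2) alpha2.
move/cvgrPdist_le : Er => /(_ _ ltr01) Er.
near=> t.
have t1 : 1 <= t by near: t; apply: nbhs_pinfty_ge; rewrite num_real.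
have tr : (`|r| + 1) / e <= t by near: t; apply: nbhs_pinfty_ge; rewrite num_real.
have t_ge0 : 0 <= t by lra.
have /ler_normlP[Et _] : `|r - energy z 2 t| <= 1 by near: t; exact: Er.
have rn := ler_norm r.
have gt0 := gap_ge0 zmin t_ge0.
have : gap z t * (t * t) <= energy z 2 t.
  rewrite /energy lerDl addr_ge0// -norm_dot mulr_ge0 ?sqr_ge0// divr_ge0//.
  by rewrite mulr_ge0// subr_ge0.
have : `|r| + 1 <= t * e by rewrite -ler_pdivrMr.
have : gap z t * t <= gap z t * (t * t).
  by apply: ler_wpM2l => //; rewrite ler_peMr.
have t_gt0 : 0 < t by lra.
move=> h1 h2 h3; rewrite -(ler_pM2r t_gt0); lra.
Unshelve. all: by end_near. Qed.

(** The tangent at [p] is taken at a fixed level [m] instead of [mu t]: its slope [D m p] is then a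
    fixed vector, and weak convergence makes the linear term small. The comparison of [ft] at level
    [m] with [f], at [p] and at [x t], costs [2 * (kappa * m)], and [m] is made small at the end. *)
Lemma weak_cluster_argmin z (U : set_system R) p : argmin f z ->
  ProperFilter U -> +oo `<=` U ->
  (forall y, dot (x t) y @[t --> U] --> dot p y) -> argmin f p.
Proof.
move=> zmin UU oU xp y; apply: le_trans (zmin y).
have main m e : 0 < m -> 0 < e -> f p <= f z + 2 * (kappa * m) + 2 * e.
  move=> m0 e0.
  have /cvgrPdist_le/(_ _ e0) xpD := xp (D m p).
  have gape := oU _ (gap_near_le zmin e0).
  have pos : U [set t | 0 <= t].
    by apply: oU; apply: nbhs_pinfty_ge; rewrite num_real.
  have [t [/= [xpt gt] t_ge0]] := filter_ex (filterI (filterI xpD gape) pos).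
  have := D_le p (x t) m0; rewrite dotDr dotNr (dotC dot _ (x t)) (dotC dot _ p).
  have := smoothing_ge fts kappaP (x t) m0.
  have := smoothing_le fts kappaP (x t) (mu_gt0 t_ge0).
  have := smoothing_le fts kappaP p m0.
  by move: gt xpt => + /ler_normlP[]; rewrite /gap; lra.
apply/ler_addgt0Pr => e e0.
have kappa0 : 0 <= kappa := kappa_ge0.
(* With this level [2 * (kappa * m)] is at most [e / 2], also when [kappa = 0], and the tolerance
   [e / 4] in [main] contributes the other half. *)
have m0 : 0 < e / (4 * (kappa + 1)) by rewrite divr_gt0//; lra.
have e40 : 0 < e / 4 by rewrite divr_gt0.
have := main _ _ m0 e40.
have : kappa * (e / (4 * (kappa + 1))) <= e / 4.
  have -> : e / 4 = (kappa + 1) * (e / (4 * (kappa + 1))) by field; lra.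
  by apply: ler_wpM2r; [exact: ltW|lra].
lra.
Qed.

Lemma trajectory_weakly_converges : argmin f !=set0 ->
  exists2 p, argmin f p & weakly_converges dot x p.
Proof.
move=> [z zmin]; apply: (opial norm_dot); first by exists z.
- exact: norm_sub_cvg.
- by move=> U p UU oU; exact: weak_cluster_argmin zmin _ oU.
Qed.

End trajectory.

Theorem theorem4p2 (R : realType) (H : completeNormedModType R)
    (dot : {dot H for idfun}) (norm_dot : forall u : H, `|u| ^+ 2 = dot u u)
    (f : H -> R) (f_convex : convex_function setT f)
    (argmin_f : argmin f !=set0)
    (ft : H -> R -> R) (ft_smoothing : smoothing_function dot f ft)
    (alpha t0 : R) (alpha_gt3 : 3 < alpha) (t0_gt0 : 0 < t0)
    (mu : R -> R) (mu_ge0 : forall t, 0 <= t -> 0 <= mu t)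
    (mu_C1 : exists dmu : R -> R, C1_from 0 mu dmu)
    (mu_decreasing : forall s t, 0 <= s -> s < t -> mu t < mu s)
    (mu_cvg0 : mu t @[t --> +oo] --> 0)
    (mu_integral :
      (\int[@lebesgue_measure R]_(t in `[t0, +oo[) (t * mu t)%:E < +oo)%E)
    (g : R -> H) (g_measurable : strongly_measurable_from t0 g)
    (g_integral :
      (\int[@lebesgue_measure R]_(t in `[t0, +oo[) (t * `|g t|)%:E < +oo)%E)
    (x : R -> H) (x_trajectory : trajectory dot ft alpha t0 mu g x) :
  exists2 xbar : H, argmin f xbar & weakly_converges dot x xbar.
Proof.
have [dmu mu1] := mu_C1; have [v [xv v_ac ode]] := x_trajectory.
have [kappa _ kappaP] := smoothing_param_bound ft_smoothing.
have [L L0 lip] := smoothing_lipschitz ft_smoothing.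
have mu_gt0 (t : R) : 0 <= t -> 0 < mu t.
  move=> t_ge0; have tt1 : t < t + 1 by rewrite ltrDl.
  by apply: le_lt_trans (mu_ge0 _ _) (mu_decreasing _ _ t_ge0 tt1); rewrite addr_ge0.
have g_primitive := bounded_primitive_strongly_measurable t0_gt0 g_measurable g_integral.
have mu_primitive : bounded_primitive t0 (fun t => t * mu t).
  apply: bounded_primitive_continuous => //.
    apply: continuous_in_subspaceT => t /set_mem; rewrite /= in_itv/= andbT => t0t.
    have t_gt0 : 0 < t by exact: lt_le_trans t0t.
    apply: cvgM; first exact: cvg_id.
    apply: differentiable_continuous; apply/derivable1_diffP.
    by case: (C1_from_derive mu1 t_gt0).
  move=> t t0t; have t_ge0 := le_trans (ltW t0_gt0) t0t.
  by rewrite mulr_ge0// mu_ge0.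
apply: (@trajectory_weakly_converges R H dot norm_dot f ft ft_smoothing kappa kappaP
  alpha t0 mu dmu x v t0_gt0 alpha_gt3 mu_gt0 mu1 mu_decreasing xv v_ac
  (fun m y => grad dot (ft^~ m) y) _ _ _ L (ltW L0) _ g ode g_primitive mu_primitive argmin_f).
- by move=> m y w m0; exact: (smoothing_gradient_le norm_dot ft_smoothing y w m0).
- by move=> m /(smoothing_C1_space ft_smoothing)[].
- by move=> y m m0; exact: (@smoothing_grad_continuous _ _ _ _ _ ft_smoothing y m m0).
- by move=> m y w m0; exact: (lip m m0 (y, w)).
Qed.
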